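(* Let $\mathfrak g=\mathfrak{so}(2n+1,\mathbb C)$ and $G=\mathrm{SO}(2n+1)$ with $n\ge2$, and let $k\ge0$ be an integer. For $\mu\in P(\mathfrak g)\setminus P(G)$, write $r(\mu)=k+\frac n2-\|\mu\|$ (an integer). Then $$m_{\pi_{k\omega_1+\omega_n}}(\mu)=\binom{r(\mu)+n-1}{n-1}.$$ Moreover, $m_{\pi_{k\omega_1+\omega_n}}(\mu)=0$ for all $\mu\in P(G)$.
   Context: $\mathfrak g=\mathfrak{so}(2n+1,\mathbb C)$ (type $B_n$) has standard basis $\varepsilon_1,\dots,\varepsilon_n$ of $\mathfrak h^*$ and positive roots $\varepsilon_i\pm\varepsilon_j$ ($i<j$) and $\varepsilon_i$. The weight lattice $P(\mathfrak g)$ consists of $\sum a_i\varepsilon_i$ with either all $a_i\in\mathbb Z$ or all $a_i\in\tfrac12+\mathbb Z$. The lattice $P(G)$ is $\mathbb Z\varepsilon_1\oplus\dots\oplus\mathbb Z\varepsilon_n$. $\omega_1=\varepsilon_1$ and $\omega_n=\tfrac12(\varepsilon_1+\dots+\varepsilon_n)$. $\pi_\lambda$ is the irreducible representation with highest weight $\lambda$, $m_\pi(\mu)$ is the weight multiplicity, and $\|\mu\|=\sum|a_j|$. Convention: $\binom{b}{a}=0$ if $a<0$ or $b<a$. *)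

(* Defs.v *)
From HB Require Import structures.
From mathcomp Require Import all_boot all_order all_algebra all_field.
Unset Printing Implicit Defensive.
Import Order.TTheory GRing.Theory Num.Theory.
Local Open Scope ring_scope.

(* Realisation of so(2n+1) over an algebraically closed field C of char 0
   (numClosedFieldType), on C^(2n+1) with basis indexed by 'I_(2n+1):
   index 0 = zero weight, index i.+1 (i < n) = weight +eps_i,
   index i.+1 + n (i < n) = weight -eps_i.  The invariant symmetric form J
   pairs index 0 with itself and i.+1 with i.+1+n. *)
Section SO.
Variable C : numClosedFieldType.
Variable n : nat.
Notation N := (n.*2.+1).

Definition Jform : 'M[C]_N :=
  \matrix_(a, b) ((((a : nat) == 0%N) && ((b : nat) == 0%N)) ||
                  [&& (a : nat) != 0%N, (b : nat) != 0%N &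
                      (((a : nat) + n == b)%N || ((b : nat) + n == a)%N)])%:R.

Definition so_mem (X : 'M[C]_N) : Prop := X^T *m Jform + Jform *m X = 0.

(* Cartan basis H_i (i < n): eps_j(H_i) = delta_ij. *)
Definition Hcart (i : 'I_n) : 'M[C]_N :=
  \matrix_(a, b) (if a == b then
                    (if (a : nat) == i.+1 then 1
                     else if (a : nat) == (i.+1 + n)%N then -1 else 0)
                  else 0).

Definition delta (i l : 'I_n) : int := (i == l)%:Z.

Definition posroot (al : 'I_n -> int) : Prop :=
  (exists i j : 'I_n, (i < j)%N /\ forall l, al l = delta i l - delta j l) \/
  (exists i j : 'I_n, (i < j)%N /\ forall l, al l = delta i l + delta j l) \/
  (exists i : 'I_n, forall l, al l = delta i l).

Definition rootvec (al : 'I_n -> int) (X : 'M[C]_N) : Prop :=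
  so_mem X /\ forall i, Hcart i *m X - X *m Hcart i = (al i)%:~R *: X.

Variable d : nat.

(* finite-dimensional representation on C^d (column vectors, v |-> rho X *m v) *)
Definition is_rep (rho : 'M[C]_N -> 'M[C]_d) : Prop :=
  (forall (a : C) X Y, so_mem X -> so_mem Y -> rho (a *: X + Y) = a *: rho X + rho Y) /\
  (forall X Y, so_mem X -> so_mem Y ->
     rho (X *m Y - Y *m X) = rho X *m rho Y - rho Y *m rho X).

(* irreducible: every invariant subspace is 0 or everything.  A subspace is the
   row space of U; its vectors are u^T for rows u of U. *)
Definition irreducible_rep (rho : 'M[C]_N -> 'M[C]_d) : Prop :=
  forall U : 'M[C]_d, (forall X, so_mem X -> (U *m (rho X)^T <= U)%MS) ->
    U = 0 \/ row_full U.

Definition has_highest_weight (rho : 'M[C]_N -> 'M[C]_d) (lam : 'I_n -> rat) : Prop :=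
  exists v : 'cV[C]_d, v != 0 /\
    (forall i, rho (Hcart i) *m v = ratr (lam i) *: v) /\
    (forall al X, posroot al -> rootvec al X -> rho X *m v = 0).

Definition wmult (rho : 'M[C]_N -> 'M[C]_d) (mu : 'I_n -> rat) : nat :=
  \rank (\bigcap_(i < n) kermx ((rho (Hcart i))^T - (ratr (mu i))%:M))%MS.

End SO.

(* k omega_1 + omega_n = (k + 1/2, 1/2, ..., 1/2) *)
Definition lam_k (n k : nat) : 'I_n -> rat :=
  fun i => (if (i : nat) == 0%N then k%:R else 0) + 2%:R^-1.

Definition in_PG (n : nat) (mu : 'I_n -> rat) : Prop :=
  forall i, exists z : int, mu i = z%:~R.

Definition in_Pg_minus_PG (n : nat) (mu : 'I_n -> rat) : Prop :=
  forall i, exists z : int, mu i = z%:~R + 2%:R^-1.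

Definition wnorm (n : nat) (mu : 'I_n -> rat) : rat := \sum_(i < n) `|mu i|.

Definition binomZ (b a : int) : nat :=
  if (a < 0) || (b < a) then 0%N else 'C(`|b|%N, `|a|%N).

(* Main.v *)
(* The multiplicities of an irreducible representation satisfy Freudenthal's
   recursion: the Casimir element acts by a scalar, and its trace on a weight
   space V_mu is a sum over the positive roots alpha of traces of f_alpha e_alpha,
   each of which telescopes along the string mu + alpha, mu + 2 alpha, ... because
   tr_{V_mu}(f e) = tr_{V_(mu + alpha)}(e f) and [e, f] acts on weight spaces by
   scalars.  The short-root sl2's make the multiplicities invariant under sign
   changes of coordinates, so mu may be taken with positive coordinates.  There
   the strings of eps_i + eps_j and eps_i - eps_j interleave: together they sum
   (mu_i + mu_j + u) binom(r(mu) - u + n - 1, n - 1) over all u >= 1, up to the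
   initial part of the second string, on which the norm is constant.  The
   binomial formula then solves the recursion, and the factor
   |lam + rho|^2 - |mu + rho|^2 vanishes only at mu = lam, where the multiplicity
   is 1. *)
Require Import Defs.
From HB Require Import structures.
From mathcomp Require Import all_boot all_order all_algebra all_field.
From mathcomp Require Import ring zify.
Import Order.TTheory GRing.Theory Num.Theory.
Local Open Scope ring_scope.

(** * sl2-triples and traces on subspaces *)

Section LinearAlgebra.
Context {C : numClosedFieldType} {d : nat}.
Implicit Types (V A B e f h : 'M[C]_d) (u : 'rV[C]_d).

Definition mxpow e p : 'M[C]_d := iter p (mulmx e) 1%:M.

Lemma mulmx_powS m (u : 'M[C]_(m, d)) e p :
  u *m mxpow e p.+1 = u *m e *m mxpow e p.
Proof. by rewrite /mxpow iterS mulmxA. Qed.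

Lemma mxpowSr e p : mxpow e p.+1 = mxpow e p *m e.
Proof.
elim: p => [|p IH]; first by rewrite /mxpow /= mulmx1 mul1mx.
by rewrite {1}/mxpow iterS -/(mxpow e p.+1) {1}IH mulmxA.
Qed.

Lemma eigen_shift (a x : C) e h u :
  e *m h - h *m e = a *: e -> u *m h = x *: u -> u *m e *m h = (x + a) *: (u *m e).
Proof.
move=> /eqP; rewrite subr_eq addrC => /eqP eh uh.
by rewrite -mulmxA eh mulmxDr !mulmxA uh -scalemxAl -scalemxAr scalerDl.
Qed.

Lemma eigen_shift_pow (a x : C) e h u p :
  e *m h - h *m e = a *: e -> u *m h = x *: u ->
  u *m mxpow e p *m h = (x + p%:R * a) *: (u *m mxpow e p).
Proof.
move=> eh uh; elim: p => [|p IH]; first by rewrite /mxpow /= mulmx1 mul0r addr0.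
rewrite mxpowSr mulmxA (eigen_shift _ _ _ _ _ eh IH) -natr1.
by congr (_ *: _); ring.
Qed.

(** Otherwise the vectors [u *m mxpow f p] for p = 0, ..., d would be eigenvectors of [h] for the d
    + 1 distinct eigenvalues x - p, too many for a characteristic polynomial of degree d. *)
Lemma lowering_nilpotent (x : C) f h u :
  f *m h - h *m f = - f -> u *m h = x *: u -> u *m mxpow f d = 0.
Proof.
rewrite -[RHS]scaleN1r => fh uh; apply/eqP/negPn/negP => nz.
have nzp p : (p <= d)%N -> u *m mxpow f p != 0.
  move=> lepd; apply: contra_neq nz => z0.
  have zq q : u *m mxpow f (p + q) = 0.
    elim: q => [|q IH]; first by rewrite addn0.
    by rewrite addnS mxpowSr mulmxA IH mul0mx.
  by have := zq (d - p)%N; rewrite subnKC.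
have := @max_poly_roots _ (char_poly h) [seq x - p%:R | p <- iota 0 d.+1].
rewrite size_map size_iota size_char_poly ltnn.
move/(_ (monic_neq0 (char_poly_monic h))) => abs.
suff: false by []; apply: abs.
  apply/allP => y /mapP[p]; rewrite mem_iota add0n /= ltnS => lepd ->.
  rewrite -eigenvalue_root_char; apply/eigenvalueP.
  exists (u *m mxpow f p); last exact: nzp.
  by rewrite (eigen_shift_pow _ _ _ _ _ _ fh uh) mulrN1.
rewrite map_inj_uniq ?iota_uniq // => p q /addrI /oppr_inj /eqP.
by rewrite eqr_nat => /eqP.
Qed.

(** * Injectivity of powers of the raising operator of an sl2-triple *)

Section Sl2.
Variables (e f h : 'M[C]_d).
(** Operators act on rows, which reverses products, so [efh] reads [e, f] = h. As [e] shifts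
    [h]-eigenvalues by 1, [h] is half the usual coroot, and the eigenvalue -p/2 is the usual weight
    -p. *)
Hypotheses (efh : f *m e - e *m f = h) (heE : e *m h - h *m e = e)
  (hfE : f *m h - h *m f = - f).

(* An eigenvector of [f e] for a negative eigenvalue at a nonpositive weight
   generates an infinite descending chain under [f]. *)
Lemma sl2_descent j p g u :
  u *m h = - (p%:R / 2) *: u -> u *m f *m e = - (g.+1%:R / 2) *: u ->
  u *m mxpow f j = 0 -> u = 0.
Proof.
elim: j p g u => [|j IH] p g u uh ufe; first by rewrite /mxpow /= mulmx1.
rewrite mulmx_powS => uf0.
have ufh : u *m f *m h = - (p.+2%:R / 2) *: (u *m f).
  rewrite (eigen_shift (-1) _ _ _ _ _ uh) ?scaleN1r //; by congr (_ *: _); field.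
have uf : u *m f = 0.
  (* Since f e = e f + h in row order, the eigenvalue at [u *m f] is -(g + 1)/2 - (p + 2)/2, which
     is again negative. *)
  apply: (IH p.+2 (g + p.+2)%N) uf0 => //.
  have -> : u *m f *m f *m e = u *m f *m e *m f + u *m f *m h.
    by rewrite -efh mulmxBr !mulmxA [RHS]addrC subrK.
  by rewrite ufe ufh -scalemxAl -scalerDl -addSn natrD; congr (_ *: _); field.
move: ufe; rewrite uf mul0mx => /esym/eqP; rewrite scaler_eq0 => /orP[|/eqP//].
by rewrite oppr_eq0 mulf_eq0 invr_eq0 !pnatr_eq0.
Qed.

(** Moving [f] to the left past l factors [e] subtracts the weights x + 1, ..., x + l met on the
    way; their sum is l x + l (l + 1)/2. *)
Lemma sl2_commute_pow l (x : C) u : u *m h = x *: u ->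
  u *m mxpow e l *m e *m f =
  (u *m e *m f - (l%:R * x + l%:R * (l%:R + 1) / 2) *: u) *m mxpow e l.
Proof.
elim: l x u => [|l IH] x u uh.
  by rewrite /mxpow /= !mulmx1 !mul0r addr0 scale0r subr0.
have ueh : u *m e *m h = (x + 1) *: (u *m e).
  by apply: eigen_shift uh; rewrite scale1r.
rewrite !mulmx_powS (IH _ _ ueh).
have -> : u *m e *m e *m f = u *m e *m f *m e - (x + 1) *: (u *m e).
  by rewrite -ueh -efh mulmxBr !mulmxA opprB [RHS]addrC subrK.
rewrite [in RHS]mulmxBl -[in RHS]scalemxAl -[l.+1%:R]natr1.
rewrite -[X in X *m _ = _]addrA -opprD -scalerDl.
by congr ((_ - _ *: _) *m _); field.
Qed.

(** Induction on the power l that kills the vector. By [sl2_commute_pow] and the induction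
    hypothesis, a vector killed by the power l + 1 is an eigenvector of e f, hence of f e; the
    latter eigenvalue is negative as long as l < p, which [sl2_descent] forbids. *)
Lemma sl2_raising_inj p u :
  u *m h = - (p%:R / 2) *: u -> u *m mxpow e p = 0 -> u = 0.
Proof.
move=> uh; suff H l : (l <= p)%N -> forall w : 'rV_d, w *m h = - (p%:R / 2) *: w ->
    w *m mxpow e l = 0 -> w = 0 by exact: H (leqnn p) u uh.
elim: l => [|l IH] lep w wh; first by rewrite /mxpow /= mulmx1.
rewrite mxpowSr mulmxA => w0.
have := sl2_commute_pow l _ _ wh; rewrite w0 mul0mx => /esym wl.
have wef0 : w *m e *m f - (l%:R * (- (p%:R / 2)) + l%:R * (l%:R + 1) / 2) *: w = 0.
  apply: (IH (ltnW lep)) wl.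
  rewrite mulmxBl scalerBr -scalemxAl wh; congr (_ - _); last first.
    by rewrite !scalerA mulrC.
  have weh : w *m e *m h = (- (p%:R / 2) + 1) *: (w *m e).
    by apply: eigen_shift wh; rewrite scale1r.
  rewrite (eigen_shift (-1) _ _ _ _ _ weh) ?scaleN1r //; by congr (_ *: _); ring.
move/eqP: wef0; rewrite subr_eq0 => /eqP wef.
have wfe : w *m f *m e =
    (- (p%:R / 2) + (l%:R * (- (p%:R / 2)) + l%:R * (l%:R + 1) / 2)) *: w.
  by rewrite scalerDl -wef -wh -efh mulmxBr !mulmxA subrK.
have [q pE] : exists q, p = (l + q).+1.
  by exists (p - l.+1)%N; rewrite -addSn subnKC.
(* The eigenvalue is -(l + 1)(p - l)/2 = -(l + 1)(q + 1)/2, which fixes the witness l q + l + q. *)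
apply: (sl2_descent d p (l * q + l + q)%N) => //.
  rewrite wfe pE; congr (_ *: _).
  rewrite -!natr1 !natrD !natrM; by field.
by apply: lowering_nilpotent wh.
Qed.

Lemma sl2_rank_pow p (V : 'M[C]_d) : V *m h = - (p%:R / 2) *: V ->
  \rank (V *m mxpow e p) = \rank V.
Proof.
move=> Vh; rewrite -(mxrank_mul_ker V (mxpow e p)).
suff -> : (V :&: kermx (mxpow e p))%MS = 0 by rewrite mxrank0 addn0.
apply/eqP; rewrite -submx0; apply/rV_subP => u.
rewrite sub_capmx sub_kermx => /andP[/submxP[D ->] /eqP u0].
rewrite (sl2_raising_inj p (D *m V) _ u0) ?sub0mx //.
by rewrite -mulmxA Vh scalemxAr.
Qed.

End Sl2.

(** If the row space of [V] is stable under [A], this is the trace of the restriction of [A] to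
    it. *)
Definition subtrace (V A : 'M[C]_d) : C :=
  \tr (row_base V *m A *m pinvmx (row_base V)).

Lemma subtraceD V A B : subtrace V (A + B) = subtrace V A + subtrace V B.
Proof. by rewrite /subtrace mulmxDr mulmxDl mxtraceD. Qed.

Lemma subtrace0 V : subtrace V 0 = 0.
Proof. by rewrite /subtrace mulmx0 mul0mx mxtrace0. Qed.

Lemma subtrace_sum (I : Type) (r : seq I) (P : pred I) V (F : I -> 'M[C]_d) :
  subtrace V (\sum_(i <- r | P i) F i) = \sum_(i <- r | P i) subtrace V (F i).
Proof. exact: (big_morph _ (subtraceD V) (subtrace0 V)). Qed.

Lemma row_base_pinv V : row_base V *m pinvmx (row_base V) = 1%:M.
Proof. by apply: mulmxVp; rewrite row_base_free. Qed.

Lemma subtrace_scalar V A (c : C) : V *m A = c *: V -> subtrace V A = c * (\rank V)%:R.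
Proof.
move=> VA; rewrite /subtrace.
have -> : row_base V *m A = c *: row_base V.
  have [D ->] : exists D, row_base V = D *m V by apply/submxP; rewrite eq_row_base.
  by rewrite -mulmxA VA scalemxAr.
by rewrite -scalemxAl row_base_pinv linearZ /= mxtrace1.
Qed.

Lemma subtrace_rank0 V A : \rank V = 0%N -> subtrace V A = 0.
Proof. by move=> V0; apply: big1 => -[i lti]; exfalso; rewrite V0 in lti. Qed.

Lemma mxtrace_swap r r' A B (b : 'M[C]_(r, d)) (b' : 'M[C]_(r', d)) p p' P Q :
  b *m A = P *m b' -> b' *m B = Q *m b -> b *m p = 1%:M -> b' *m p' = 1%:M ->
  \tr (b *m (A *m B) *m p) = \tr (b' *m (B *m A) *m p').
Proof.
move=> PE QE bp bp'.
rewrite !mulmxA PE QE -(mulmxA P) -(mulmxA Q) PE QE -!mulmxA bp bp' !mulmx1.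
by rewrite mxtrace_mulC.
Qed.

(** In bases of the two row spaces, [A] and [B] become rectangular matrices P and Q, and tr(PQ) =
    tr(QP). *)
Lemma subtrace_cyclic V V' A B :
  (V *m A <= V')%MS -> (V' *m B <= V)%MS ->
  subtrace V (A *m B) = subtrace V' (B *m A).
Proof.
move=> VA VB; rewrite /subtrace.
have bVA : (row_base V *m A <= row_base V')%MS.
  by rewrite eq_row_base (submx_trans _ VA) // submxMr // eq_row_base.
have bVB : (row_base V' *m B <= row_base V)%MS.
  by rewrite eq_row_base (submx_trans _ VB) // submxMr // eq_row_base.
exact: mxtrace_swap _ _ _ _ _ _ _ _ _ _ (esym (mulmxKpV bVA)) (esym (mulmxKpV bVB))
  (row_base_pinv V) (row_base_pinv V').
Qed.

End LinearAlgebra.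

(** * Root vectors of so(2n+1) *)

Section OrthogonalAlgebra.
Context {C : numClosedFieldType} {n : nat}.
Local Notation N := (n.*2.+1).
Implicit Types (a b c : 'I_N) (i j : 'I_n) (X : 'M[C]_N).

Lemma pidx_proof i : (i.+1 < N)%N.
Proof. by have := ltn_ord i; lia. Qed.
Lemma nidx_proof i : (i.+1 + n < N)%N.
Proof. by have := ltn_ord i; lia. Qed.

Definition pidx i : 'I_N := Ordinal (pidx_proof i).
Definition nidx i : 'I_N := Ordinal (nidx_proof i).

Variant index_spec a : Prop :=
  | IndexZero of a = ord0
  | IndexPos i of a = pidx i
  | IndexNeg i of a = nidx i.

Lemma indexP a : index_spec a.
Proof.
case: (posnP a) => [a0|agt0]; first by apply: IndexZero; apply: val_inj.
have ltaN := ltn_ord a.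
case: (leqP a n) => [lean|ltna].
  have lt : (a.-1 < n)%N by lia.
  by apply: (IndexPos _ (Ordinal lt)); apply: val_inj => /=; lia.
have lt : (a.-1 - n < n)%N by lia.
by apply: (IndexNeg _ (Ordinal lt)); apply: val_inj => /=; lia.
Qed.

Lemma big_index (V : nmodType) (F : 'I_N -> V) :
  \sum_a F a = F ord0 + (\sum_i F (pidx i) + \sum_i F (nidx i)).
Proof.
pose G k := F (inord k).
rewrite (eq_bigr (fun a => G (val a))) => [|a _]; last by rewrite /G inord_val.
rewrite -(big_mkord xpredT G) big_nat_recl // (@big_cat_nat _ _ _ n) //=; last by lia.
congr (_ + (_ + _)).
- by rewrite /G; congr F; apply: val_inj; rewrite /= inordK.
- rewrite big_mkord; apply: eq_bigr => i _; rewrite /G; congr F.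
  by apply: val_inj; rewrite /= inordK //; apply: pidx_proof.
rewrite -[X in \sum_(X <= _ < _) _]add0n big_addn -addnn addnK big_mkord.
apply: eq_bigr => i _; rewrite /G; congr F.
by apply: val_inj; rewrite /= inordK //; apply: nidx_proof.
Qed.

(** The involution that negates weights; [JformE] shows that the invariant form pairs each index
    with its image. *)
Definition bar a : 'I_N :=
  if (a : nat) == 0%N then a
  else if (a <= n)%N then inord (a + n) else inord (a - n).

Lemma bar0 : bar ord0 = ord0. Proof. by []. Qed.

Lemma bar_pidx i : bar (pidx i) = nidx i.
Proof.
rewrite /bar /= ltn_ord; apply: val_inj; rewrite /= inordK //.
exact: nidx_proof.
Qed.

Lemma bar_nidx i : bar (nidx i) = pidx i.
Proof.
rewrite /bar /= addnK ifF; last by have := ltn_ord i; lia.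
by apply: val_inj; rewrite /= inordK //; apply: pidx_proof.
Qed.

Definition barE := (bar0, bar_pidx, bar_nidx).

Lemma barK : involutive bar.
Proof. by move=> a; case: (indexP a) => [|i|i] ->; rewrite !barE. Qed.

Lemma bar_eq a b : (bar a == b) = (a == bar b).
Proof. by rewrite -(inj_eq (can_inj barK)) barK. Qed.

Lemma pidx_eq i j : (pidx i == pidx j) = (i == j).
Proof. by rewrite -!val_eqE /= eqSS. Qed.
Lemma nidx_eq i j : (nidx i == nidx j) = (i == j).
Proof. by rewrite -!val_eqE /= eqn_add2r eqSS. Qed.
Lemma pidx_nidx i j : (pidx i == nidx j) = false.
Proof. by rewrite -!val_eqE /=; have := ltn_ord i; lia. Qed.
Lemma nidx_pidx i j : (nidx i == pidx j) = false.
Proof. by rewrite eq_sym pidx_nidx. Qed.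
Lemma ord0_pidx i : (ord0 == pidx i) = false. Proof. by []. Qed.
Lemma ord0_nidx i : (ord0 == nidx i) = false. Proof. by []. Qed.
Lemma pidx_ord0 i : (pidx i == ord0) = false. Proof. by []. Qed.
Lemma nidx_ord0 i : (nidx i == ord0) = false. Proof. by []. Qed.

Definition idxE := (pidx_eq, nidx_eq, pidx_nidx, nidx_pidx, ord0_pidx, ord0_nidx,
  pidx_ord0, nidx_ord0).

Lemma JformE a b : Jform C n a b = (b == bar a)%:R.
Proof.
rewrite mxE; congr (_%:R).
case: (indexP a) => [|i|i] ->; case: (indexP b) => [|j|j] ->; rewrite !barE ?idxE //=.
all: rewrite -?val_eqE /=; have := ltn_ord i; have := ltn_ord j; lia.
Qed.

Lemma so_memP X : so_mem C n X <-> forall a b, X a b = - X (bar b) (bar a).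
Proof.
have E a b : (X^T *m Jform C n + Jform C n *m X) a b = X (bar b) a + X (bar a) b.
  rewrite !mxE; congr (_ + _).
    rewrite (bigD1 (bar b)) //= big1 => [|c ne].
      by rewrite mxE JformE barK eqxx mulr1 addr0.
    by rewrite mxE JformE eq_sym bar_eq (negbTE ne) mulr0.
  rewrite (bigD1 (bar a)) //= big1 => [|c ne]; first by rewrite JformE eqxx mul1r addr0.
  by rewrite JformE (negbTE ne) mul0r.
split=> [soX a b | soX].
  have := E (bar a) b; rewrite soX mxE barK => /esym/eqP.
  by rewrite addrC addr_eq0 => /eqP.
by apply/matrixP => a b; rewrite E mxE [X (bar a) b]soX barK subrr.
Qed.

(** A matrix unit made antisymmetric for the form: a root vector for [wt a - wt b] if b is neither a
    nor [bar a], and a Cartan element if b = a. The pairs (a, b) and ([bar b], [bar a]) give the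
    same element up to sign. *)
Definition Xroot a b : 'M[C]_N := delta_mx a b - delta_mx (bar b) (bar a).

Lemma XrootE a b c d : Xroot a b c d =
  ((c == a) && (d == b))%:R - ((c == bar b) && (d == bar a))%:R.
Proof. by rewrite !mxE. Qed.

Lemma Xroot_so a b : so_mem C n (Xroot a b).
Proof.
apply/so_memP => c d; rewrite !XrootE opprB !bar_eq !barK.
by rewrite [(d == bar a) && _]andbC [(d == b) && _]andbC.
Qed.

Lemma Xroot_bar a b : Xroot (bar b) (bar a) = - Xroot a b.
Proof. by rewrite /Xroot !barK opprB. Qed.

Lemma Xroot_bar0 a : Xroot a (bar a) = 0.
Proof. by rewrite /Xroot barK subrr. Qed.

(** The factor 1/2 compensates for each element occurring at two pairs of indices. *)
Lemma so_decomp X : so_mem C n X ->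
  X = \sum_a \sum_b (2^-1 * X a b) *: Xroot a b.
Proof.
move=> /so_memP soX; apply/matrixP => c d.
rewrite summxE; under eq_bigr => a _.
  rewrite summxE; under eq_bigr => b _ do rewrite mxE XrootE mulrBr.
  rewrite sumrB; over.
rewrite sumrB.
rewrite (bigD1 c) //= [X in _ + X - _]big1 ?addr0; last first.
  by move=> a ne; apply: big1 => b _; rewrite eq_sym (negbTE ne) mulr0.
rewrite (bigD1 d) //= [X in _ + X - _]big1 ?addr0; last first.
  by move=> b ne; rewrite [d == b]eq_sym (negbTE ne) andbF mulr0.
rewrite (bigD1 (bar d)) //= [X in _ - (_ + X)]big1 ?addr0; last first.
  by move=> a ne; apply: big1 => b _; rewrite [d == _]eq_sym bar_eq (negbTE ne) andbF mulr0.
rewrite (bigD1 (bar c)) //= [X in _ - (_ + X)]big1 ?addr0; last first.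
  by move=> b ne; rewrite [c == _]eq_sym bar_eq (negbTE ne) mulr0.
rewrite !eqxx barK barK !eqxx /= !mulr1 -mulrBr [X (bar d) _]soX !barK opprK.
by field.
Qed.

(** The first halves of the [Xroot] terms give the commutator with a matrix unit; the antisymmetry
    of [X] turns the second halves into the commutator with the other unit. *)
Lemma Xroot_comm X a b : so_mem C n X ->
  X *m Xroot a b - Xroot a b *m X =
  \sum_c (X c a *: Xroot c b - X b c *: Xroot a c).
Proof.
move=> /so_memP soX; apply/matrixP => c d.
rewrite !mxE summxE.
have -> : \sum_j X c j * Xroot a b j d =
    X c a * (d == b)%:R - X c (bar b) * (d == bar a)%:R.
  under eq_bigr => j _ do rewrite XrootE mulrBr.
  rewrite sumrB (bigD1 a) //= [X in _ + X - _]big1 ?addr0; last first.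
    by move=> j ne; rewrite (negbTE ne) mulr0.
  rewrite (bigD1 (bar b)) //= [X in _ - (_ + X)]big1 ?addr0; last first.
    by move=> j ne; rewrite (negbTE ne) mulr0.
  by rewrite !eqxx.
have -> : \sum_j Xroot a b c j * X j d =
    (c == a)%:R * X b d - (c == bar b)%:R * X (bar a) d.
  under eq_bigr => j _ do rewrite XrootE mulrBl.
  rewrite sumrB (bigD1 b) //= [X in _ + X - _]big1 ?addr0; last first.
    by move=> j ne; rewrite (negbTE ne) andbF mul0r.
  rewrite (bigD1 (bar a)) //= [X in _ - (_ + X)]big1 ?addr0; last first.
    by move=> j ne; rewrite (negbTE ne) andbF mul0r.
  by rewrite !eqxx !andbT.
under eq_bigr => e _ do rewrite !mxE !mulrBr.
rewrite !sumrB.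
have S1 : \sum_e X e a * ((c == e) && (d == b))%:R = X c a * (d == b)%:R.
  rewrite (bigD1 c) //= big1 ?eqxx ?addr0 // => e ne.
  by rewrite eq_sym (negbTE ne) mulr0.
have S2 : \sum_e X e a * ((c == bar b) && (d == bar e))%:R = - ((c == bar b)%:R * X (bar a) d).
  rewrite (bigD1 (bar d)) //= big1 ?addr0 => [|e ne].
    by rewrite barK eqxx andbT [X (bar d) a]soX barK mulrC mulrN.
  by rewrite [d == _]eq_sym bar_eq (negbTE ne) andbF mulr0.
have S3 : \sum_e X b e * ((c == a) && (d == e))%:R = (c == a)%:R * X b d.
  rewrite (bigD1 d) //= big1 ?eqxx ?addr0 => [|e ne].
    by rewrite andbT mulrC.
  by rewrite [d == e]eq_sym (negbTE ne) andbF mulr0.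
have S4 : \sum_e X b e * ((c == bar e) && (d == bar a))%:R = - (X c (bar b) * (d == bar a)%:R).
  rewrite (bigD1 (bar c)) //= big1 ?addr0 => [|e ne].
    by rewrite barK eqxx /= [X b _]soX barK mulNr.
  by rewrite [c == _]eq_sym bar_eq (negbTE ne) mulr0.
by rewrite S1 S2 S3 S4; ring.
Qed.

(** For b = [bar a] the left side vanishes while the right side is twice [Xroot a a], so this pair
    is excluded. *)
Lemma Xroot_opp a b : bar a != b ->
  Xroot a b *m Xroot b a - Xroot b a *m Xroot a b = Xroot a a - Xroot b b.
Proof.
move=> ne; have ne1 : (b == bar a) = false by rewrite eq_sym (negbTE ne).
have ne2 : (a == bar b) = false by rewrite -bar_eq (negbTE ne).
rewrite Xroot_comm; last exact: Xroot_so.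
rewrite sumrB (bigD1 a) //= [X in _ + X - _]big1 => [|c nca]; last first.
  by rewrite XrootE (negbTE nca) ne1 andbF subrr scale0r.
rewrite [X in _ - X](bigD1 b) //= [X in _ - (_ + X)]big1 => [|c ncb]; last first.
  by rewrite XrootE (negbTE ncb) andbF ne2 subrr scale0r.
rewrite !XrootE !eqxx ne1 ne2 andbF /=.
by rewrite !subr0 !scale1r !addr0.
Qed.

(** * Weights of the vector representation *)

Definition eps i : {ffun 'I_n -> int} := [ffun l => (i == l)%:Z].

Definition wt a : {ffun 'I_n -> int} :=
  [ffun l => (a == pidx l)%:Z - (a == nidx l)%:Z].

Lemma wt0 : wt ord0 = 0.
Proof. by apply/ffunP => l; rewrite !ffunE. Qed.
Lemma wt_pidx i : wt (pidx i) = eps i.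
Proof. by apply/ffunP => l; rewrite !ffunE !idxE subr0. Qed.
Lemma wt_nidx i : wt (nidx i) = - eps i.
Proof. by apply/ffunP => l; rewrite !ffunE !idxE sub0r. Qed.

Definition wtE := (wt0, wt_pidx, wt_nidx).

Lemma HcartE i a b : Hcart C n i a b = (wt a i)%:~R * (a == b)%:R.
Proof.
rewrite mxE ffunE -!val_eqE /=; case: eqP => _; last by rewrite mulr0.
rewrite mulr1; case: eqP => [->|_]; last by case: eqP.
by have -> : (i.+1 == i.+1 + n)%N = false by have := ltn_ord i; lia.
Qed.

Lemma Hcart_Xroot i : Hcart C n i = Xroot (pidx i) (pidx i).
Proof.
apply/matrixP => a b; rewrite HcartE XrootE bar_pidx ffunE.
case: (a =P b) => [->|ne]; first by rewrite !andbb mulr1 rmorphB.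
have F x : (a == x) && (b == x) = false.
  by apply/negP => /andP[/eqP ax /eqP bx]; apply: ne; rewrite ax bx.
by rewrite !F subrr mulr0.
Qed.

Lemma Hcart_so i : so_mem C n (Hcart C n i).
Proof. by rewrite Hcart_Xroot; apply: Xroot_so. Qed.

Lemma Hcart_comm i a b :
  Hcart C n i *m Xroot a b - Xroot a b *m Hcart C n i =
  ((wt a - wt b) i)%:~R *: Xroot a b.
Proof.
rewrite Xroot_comm; last exact: Hcart_so.
rewrite sumrB (bigD1 a) //= [X in _ + X - _]big1 => [|c nca]; last first.
  by rewrite HcartE (negbTE nca) mulr0 scale0r.
rewrite [X in _ - X](bigD1 b) //= [X in _ - (_ + X)]big1 => [|c ncb]; last first.
  by rewrite HcartE eq_sym (negbTE ncb) mulr0 scale0r.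
by rewrite !HcartE !eqxx !mulr1 !addr0 -scalerBl -rmorphB !ffunE.
Qed.

End OrthogonalAlgebra.

(** * Representations and the Casimir element *)

Section PairSums.
Context {C : comPzRingType} {n : nat}.

Lemma sum_pairs (F : 'I_n -> 'I_n -> C) :
  \sum_i \sum_j F i j =
  \sum_i F i i + \sum_(i < n) \sum_(j < n | (i < j)%N) (F i j + F j i).
Proof.
have -> : \sum_(i < n) \sum_(j < n | (i < j)%N) (F i j + F j i) =
    \sum_(i < n) (\sum_(j < n | (i < j)%N) F i j + \sum_(j < n | (j < i)%N) F i j).
  under eq_bigr => i _ do rewrite big_split.
  rewrite !big_split; congr (_ + _).
  rewrite (exchange_big_dep xpredT) //=.
rewrite -big_split; apply: eq_bigr => i _ /=.
rewrite (bigD1 i) //= (bigID (fun j : 'I_n => (i < j)%N)) /=.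
congr (_ + (_ + _)); apply: eq_bigl => j; rewrite -val_eqE /=; lia.
Qed.

(** The two symmetries leave one term per Cartan direction and per root, each counted twice. The
    three sums collect the Cartan part, the long roots with their opposites, and the short roots
    with their opposites. *)
Lemma sum_index_pairs (T : 'I_(n.*2.+1) -> 'I_(n.*2.+1) -> C) :
  (forall a b, T (bar b) (bar a) = T a b) -> (forall a, T a (bar a) = 0) ->
  \sum_a \sum_b T a b =
  (\sum_i T (pidx i) (pidx i) +
   \sum_(i < n) \sum_(j < n | (i < j)%N)
     (T (pidx i) (pidx j) + T (pidx j) (pidx i) +
      (T (pidx i) (nidx j) + T (nidx j) (pidx i))) +
   \sum_i (T (pidx i) ord0 + T ord0 (pidx i))) *+ 2.
Proof.
move=> Tbar T0.
have T0n i : T ord0 (nidx i) = T (pidx i) ord0 by rewrite -Tbar !barE.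
have Tn0 i : T (nidx i) ord0 = T ord0 (pidx i) by rewrite -Tbar !barE.
have Tnn i j : T (nidx i) (nidx j) = T (pidx j) (pidx i) by rewrite -Tbar !barE.
have Tpn i j : T (pidx i) (nidx j) = T (pidx j) (nidx i) by rewrite -Tbar !barE.
have Tnp i j : T (nidx i) (pidx j) = T (nidx j) (pidx i) by rewrite -Tbar !barE.
pose F i j := T (pidx i) (pidx j) + T (nidx i) (nidx j) +
              (T (pidx i) (nidx j) + T (nidx i) (pidx j)).
have -> : \sum_a \sum_b T a b =
    \sum_i \sum_j F i j + (\sum_i (T (pidx i) ord0 + T ord0 (pidx i))) *+ 2.
  rewrite big_index big_index (_ : T ord0 ord0 = 0) ?add0r; last by rewrite -{2}bar0 T0.
  under [\sum_i T _ (nidx i)]eq_bigr => i _ do rewrite T0n.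
  under [X in _ + (X + _)]eq_bigr => i _ do rewrite big_index.
  under [X in _ + (_ + X)]eq_bigr => i _ do rewrite big_index Tn0.
  under [in RHS]eq_bigr => i _ do rewrite /F !big_split /=.
  by rewrite !big_split /=; ring.
have FD i : F i i = T (pidx i) (pidx i) *+ 2.
  have := T0 (nidx i); have := T0 (pidx i); rewrite bar_pidx bar_nidx.
  by rewrite /F Tnn => -> ->; rewrite !addr0 mulr2n.
have FS i j : F i j + F j i =
    (T (pidx i) (pidx j) + T (pidx j) (pidx i) +
      (T (pidx i) (nidx j) + T (nidx j) (pidx i))) *+ 2.
  by rewrite /F !Tnn [T (pidx j) (nidx i)]Tpn [T (nidx i) (pidx j)]Tnp; ring.
rewrite sum_pairs !mulrnDl; congr (_ + _ + _); rewrite -sumrMnl.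
  by apply: eq_bigr => i _.
apply: eq_bigr => i _; rewrite -sumrMnl.
by apply: eq_bigr => j _.
Qed.

End PairSums.

(** * Representations acting on row vectors, and their weight spaces *)

Section Representation.
Context {C : numClosedFieldType} {n d : nat}.
Variable rho : 'M[C]_(n.*2.+1) -> 'M[C]_d.
Hypothesis rep : is_rep C n d rho.
Local Notation N := (n.*2.+1).
Implicit Types (a b c : 'I_N) (i j : 'I_n) (X Y : 'M[C]_N) (z : {ffun 'I_n -> int}).

Lemma so_mem0 : so_mem C n 0.
Proof. by rewrite /so_mem trmx0 mul0mx mulmx0 addr0. Qed.

Lemma so_memZD (x : C) X Y : so_mem C n X -> so_mem C n Y -> so_mem C n (x *: X + Y).
Proof.
move=> /so_memP soX /so_memP soY; apply/so_memP => a b.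
by rewrite !mxE [X a b]soX [Y a b]soY mulrN opprD.
Qed.

Lemma so_mem_comm X Y : so_mem C n X -> so_mem C n Y -> so_mem C n (X *m Y - Y *m X).
Proof.
rewrite /so_mem => soX soY.
have XJ : X^T *m Jform C n = - (Jform C n *m X) by apply/eqP; rewrite -addr_eq0 soX.
have YJ : Y^T *m Jform C n = - (Jform C n *m Y) by apply/eqP; rewrite -addr_eq0 soY.
rewrite linearB /= !trmx_mul mulmxBl mulmxBr -!mulmxA XJ YJ !mulmxN !mulmxA XJ YJ.
by rewrite !mulNmx !opprK -!mulmxA addrA subrK subrr.
Qed.

(* The transpose makes the representation act on row vectors from the right,
   hence reverses products. *)
Definition act X : 'M[C]_d := (rho X)^T.

Lemma actZD (x : C) X Y : so_mem C n X -> so_mem C n Y ->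
  act (x *: X + Y) = x *: act X + act Y.
Proof. by move=> soX soY; rewrite /act rep.1 // linearP. Qed.

Lemma act0 : act 0 = 0.
Proof.
have := actZD 1 0 0 so_mem0 so_mem0; rewrite !scale1r addr0 => /eqP.
by rewrite -subr_eq subrr => /eqP.
Qed.

Lemma actZ (x : C) X : so_mem C n X -> act (x *: X) = x *: act X.
Proof.
by move=> soX; rewrite -[x *: X]addr0 actZD ?act0 ?addr0 //; apply: so_mem0.
Qed.

Lemma act_sum (I : Type) (r : seq I) (x : I -> C) (F : I -> 'M[C]_N) :
  (forall l : I, so_mem C n (F l)) ->
  so_mem C n (\sum_(l <- r) x l *: F l) /\
  act (\sum_(l <- r) x l *: F l) = \sum_(l <- r) x l *: act (F l).
Proof.
move=> soF; elim: r => [|l r [so_r act_r]].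
  by rewrite !big_nil act0; split=> //; apply: so_mem0.
by rewrite !big_cons; split; [exact: so_memZD | rewrite actZD // act_r].
Qed.

Lemma act_comm X Y : so_mem C n X -> so_mem C n Y ->
  act (X *m Y - Y *m X) = act Y *m act X - act X *m act Y.
Proof. by move=> soX soY; rewrite /act rep.2 // linearB /= !trmx_mul. Qed.

Definition Mroot a b := act (Xroot a b).

Lemma act_Hcart i : act (Hcart C n i) = Mroot (pidx i) (pidx i).
Proof. by rewrite Hcart_Xroot. Qed.

Lemma Mroot_bar a b : Mroot (bar b) (bar a) = - Mroot a b.
Proof. by rewrite /Mroot Xroot_bar -scaleN1r actZ ?scaleN1r //; apply: Xroot_so. Qed.

Lemma Mroot_bar0 a : Mroot a (bar a) = 0.
Proof. by rewrite /Mroot Xroot_bar0 act0. Qed.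

Lemma act_decomp X : so_mem C n X ->
  act X = \sum_(p : 'I_N * 'I_N) (2^-1 * X p.1 p.2) *: Mroot p.1 p.2.
Proof.
move=> soX; rewrite {1}(so_decomp X soX) pair_big /=.
by rewrite (act_sum _ _ _ (fun p => Xroot p.1 p.2) _).2 // => p; apply: Xroot_so.
Qed.

Lemma act_Mroot_comm X a b : so_mem C n X ->
  Mroot a b *m act X - act X *m Mroot a b = \sum_c (X c a *: Mroot c b - X b c *: Mroot a c).
Proof.
move=> soX; rewrite -act_comm //; last exact: Xroot_so.
rewrite Xroot_comm // !sumrB.
have [so1 act1] := act_sum _ (index_enum 'I_N) (fun c => X c a)
  (fun c => Xroot c b) (fun c => Xroot_so c b).
have [so2 act2] := act_sum _ (index_enum 'I_N) (fun c => X b c)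
  (fun c => Xroot a c) (fun c => Xroot_so a c).
rewrite -act1 -act2 addrC -scaleN1r actZD //.
by rewrite scaleN1r addrC.
Qed.

Lemma Mroot_opp a b : bar a != b ->
  Mroot b a *m Mroot a b - Mroot a b *m Mroot b a = Mroot a a - Mroot b b.
Proof.
move=> ne; rewrite -act_comm; try exact: Xroot_so.
rewrite Xroot_opp // addrC -scaleN1r actZD; try exact: Xroot_so.
by rewrite scaleN1r addrC.
Qed.

(** Up to a scalar, the Casimir element of the trace form, for which [Xroot a b] and [Xroot b a] are
    dual. *)
Definition casimir : 'M[C]_d := \sum_a \sum_b Mroot a b *m Mroot b a.

(** The commutator with [act X] is expanded by the Leibniz rule and [act_Mroot_comm]. The resulting
    triple sums cancel after their summation indices are renamed. *)
Lemma casimir_central X : so_mem C n X -> casimir *m act X = act X *m casimir.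
Proof.
move=> soX; apply/eqP; rewrite -subr_eq0 /casimir mulmx_suml mulmx_sumr -sumrB.
pose P a b c := X c a *: (Mroot c b *m Mroot b a).
pose Q a b c := X b c *: (Mroot a c *m Mroot b a).
have step a b : Mroot a b *m Mroot b a *m act X - act X *m (Mroot a b *m Mroot b a) =
    \sum_c (P a b c - Q a b c) + \sum_c (Q a c b - P c b a).
  have -> : Mroot a b *m Mroot b a *m act X - act X *m (Mroot a b *m Mroot b a) =
    (Mroot a b *m act X - act X *m Mroot a b) *m Mroot b a +
    Mroot a b *m (Mroot b a *m act X - act X *m Mroot b a).
    by rewrite mulmxBl mulmxBr !mulmxA [RHS]addrC addrA subrK.
  rewrite !act_Mroot_comm // mulmx_suml mulmx_sumr; congr (_ + _); apply: eq_bigr => c _.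
    by rewrite mulmxBl -!scalemxAl.
  by rewrite mulmxBr -!scalemxAr.
under eq_bigr => a _.
  rewrite mulmx_suml mulmx_sumr -sumrB; under eq_bigr => b _ do rewrite step.
  rewrite big_split /=; under eq_bigr => b _ do rewrite sumrB.
  under [X in _ + X]eq_bigr => b _ do rewrite sumrB.
  rewrite !sumrB; over.
rewrite big_split /= !sumrB.
have -> : \sum_a \sum_b \sum_c Q a c b = \sum_a \sum_b \sum_c Q a b c.
  by apply: eq_bigr => a _; rewrite exchange_big.
have -> : \sum_a \sum_b \sum_c P c b a = \sum_a \sum_b \sum_c P a b c.
  rewrite exchange_big [RHS]exchange_big /=; apply: eq_bigr => b _.
  by rewrite exchange_big.
by rewrite addrC addrA subrK subrr.
Qed.

(* The integer vector [z] encodes the weight [z + (1/2, ..., 1/2)]. *)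
Definition chi z i : C := (z i)%:~R + 2^-1.

Definition weight_vector {m} (u : 'M[C]_(m, d)) z :=
  forall i, u *m act (Hcart C n i) = chi z i *: u.

Definition wspace z : 'M[C]_d :=
  (\bigcap_(i < n) kermx (act (Hcart C n i) - (chi z i)%:M))%MS.

Lemma sub_wspace m (u : 'M[C]_(m, d)) z : (u <= wspace z)%MS <-> weight_vector u z.
Proof.
split=> [/sub_bigcapmxP uz i|uz].
  have := uz i isT; rewrite sub_kermx mulmxBr mul_mx_scalar subr_eq0.
  by move/eqP.
apply/sub_bigcapmxP => i _.
by rewrite sub_kermx mulmxBr mul_mx_scalar uz subrr.
Qed.

Lemma weight_wspace z : weight_vector (wspace z) z.
Proof. exact/sub_wspace. Qed.

Lemma Mroot_cartan i a b :
  Mroot a b *m act (Hcart C n i) - act (Hcart C n i) *m Mroot a b =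
  ((wt a - wt b) i)%:~R *: Mroot a b.
Proof.
rewrite -act_comm ?Hcart_comm ?actZ //; by [exact: Xroot_so | exact: Hcart_so].
Qed.

Lemma weight_shift m (u : 'M[C]_(m, d)) z a b :
  weight_vector u z -> weight_vector (u *m Mroot a b) (z + (wt a - wt b)).
Proof.
move=> uz i; have /eqP := Mroot_cartan i a b; rewrite subr_eq => /eqP E.
rewrite -mulmxA E mulmxDr mulmxA uz -scalemxAr -scalemxAl -scalerDl.
by congr (_ *: _); rewrite /chi [in RHS]ffunE rmorphD /=; ring.
Qed.

Lemma wspace_shift z a b : (wspace z *m Mroot a b <= wspace (z + (wt a - wt b))%R)%MS.
Proof. by apply/sub_wspace/weight_shift/weight_wspace. Qed.

(* The eigenvalue of [Xroot a a] on the weight encoded by [z]. *)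
Definition diag_wt z a : C := \sum_i (wt a i)%:~R * chi z i.

Lemma diag_wt0 z : diag_wt z ord0 = 0.
Proof. by apply: big1 => i _; rewrite wt0 ffunE mul0r. Qed.

Lemma diag_wt_pidx z i : diag_wt z (pidx i) = chi z i.
Proof.
rewrite /diag_wt wt_pidx (bigD1 i) //= big1 => [|l ne].
  by rewrite ffunE eqxx mul1r addr0.
by rewrite ffunE eq_sym (negbTE ne) mul0r.
Qed.

Lemma diag_wt_nidx z i : diag_wt z (nidx i) = - chi z i.
Proof.
rewrite -diag_wt_pidx /diag_wt -sumrN; apply: eq_bigr => l _.
by rewrite wt_nidx wt_pidx !ffunE rmorphN mulNr.
Qed.

Definition diag_wtE := (diag_wt0, diag_wt_pidx, diag_wt_nidx).

Lemma weight_diag m (u : 'M[C]_(m, d)) z a :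
  weight_vector u z -> u *m Mroot a a = diag_wt z a *: u.
Proof.
move=> uz; case: (indexP a) => [|i|i] ->; rewrite diag_wtE.
- by rewrite -{2}bar0 Mroot_bar0 mulmx0 scale0r.
- by rewrite -act_Hcart uz.
by rewrite -!bar_pidx Mroot_bar -act_Hcart mulmxN uz scaleNr.
Qed.

Lemma weight_opp m (u : 'M[C]_(m, d)) z a b : weight_vector u z -> bar a != b ->
  u *m (Mroot b a *m Mroot a b - Mroot a b *m Mroot b a) = (diag_wt z a - diag_wt z b) *: u.
Proof. by move=> uz ne; rewrite Mroot_opp // mulmxBr !(weight_diag _ _ z) // scalerBl. Qed.

End Representation.

(** * Highest weight vectors and Freudenthal's formula *)

Section Height.
Context {n : nat}.
Local Notation N := (n.*2.+1).
Implicit Types (a b : 'I_N) (i j : 'I_n) (z : {ffun 'I_n -> int}).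

(** The coefficients n, n - 1, ..., 1 are positive and strictly decreasing, so this functional is
    positive on every positive root and separates the weights of the vector representation. *)
Definition ht z : int := \sum_(i < n) (n - i)%N%:Z * z i.
Definition wtotal z : int := \sum_(i < n) z i.

Lemma htD z z' : ht (z + z') = ht z + ht z'.
Proof. by rewrite -big_split; apply: eq_bigr => i _; rewrite ffunE mulrDr. Qed.
Lemma htN z : ht (- z) = - ht z.
Proof. by rewrite -sumrN; apply: eq_bigr => i _; rewrite ffunE mulrN. Qed.
Lemma ht0 : ht 0 = 0.
Proof. by apply: big1 => i _; rewrite ffunE mulr0. Qed.
Lemma ht_eps i : ht (eps i) = (n - i)%N.
Proof.
rewrite /ht (bigD1 i) //= big1 => [|l ne]; first by rewrite ffunE eqxx mulr1 addr0.
by rewrite ffunE eq_sym (negbTE ne) mulr0.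
Qed.

Lemma wtotalD z z' : wtotal (z + z') = wtotal z + wtotal z'.
Proof. by rewrite -big_split; apply: eq_bigr => i _; rewrite ffunE. Qed.
Lemma wtotalN z : wtotal (- z) = - wtotal z.
Proof. by rewrite -sumrN; apply: eq_bigr => i _; rewrite ffunE. Qed.
Lemma wtotal0 : wtotal 0 = 0.
Proof. by apply: big1 => i _; rewrite ffunE. Qed.
Lemma wtotal_eps i : wtotal (eps i) = 1.
Proof.
rewrite /wtotal (bigD1 i) //= big1 => [|l ne]; first by rewrite ffunE eqxx addr0.
by rewrite ffunE eq_sym (negbTE ne).
Qed.

Definition htE := (ht0, htN, ht_eps).
Definition wtotalE := (wtotal0, wtotalN, wtotal_eps).

Lemma ht_wt_inj a b : ht (wt a) = ht (wt b) -> a = b.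
Proof.
case: (indexP a) => [|i|i] ->; case: (indexP b) => [|j|j] ->; rewrite !wtE !htE //.
all: try (have lti := ltn_ord i); try (have ltj := ltn_ord j); try lia.
- by move=> eij; congr pidx; apply: ord_inj; lia.
- by move=> eij; congr nidx; apply: ord_inj; lia.
Qed.

(** Positive roots have coordinate sum 0, 1 or 2. Thus lowering never increases the coordinate sum,
    which later bounds the norm of a weight. *)
Lemma ht_total_wt a b : ht (wt a) < ht (wt b) -> wtotal (wt a) <= wtotal (wt b).
Proof.
case: (indexP a) => [|i|i] ->; case: (indexP b) => [|j|j] ->; rewrite !wtE !htE !wtotalE //.
all: try (have lti := ltn_ord i); try (have ltj := ltn_ord j); lia.
Qed.

Lemma posroot_wt a b : ht (wt b) < ht (wt a) -> bar a != b -> posroot n (wt a - wt b).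
Proof.
case: (indexP a) => [|i|i] ->; case: (indexP b) => [|j|j] ->;
  rewrite !wtE !htE ?barE ?idxE //.
all: try (have lti := ltn_ord i); try (have ltj := ltn_ord j); try lia.
- by move=> _ _; right; right; exists j => l; rewrite sub0r opprK ffunE.
- by move=> _ _; right; right; exists i => l; rewrite subr0 ffunE.
- move=> lt _; left; exists i, j; split; first by lia.
  by move=> l; rewrite !ffunE.
- move=> _ ne; right; left; case: (ltngtP i j) => [lt|lt|eq_ij].
  + by exists i, j; split => // l; rewrite opprK !ffunE.
  + by exists j, i; split => // l; rewrite opprK !ffunE addrC.
  + by case/eqP: ne; apply: ord_inj.
- move=> lt _; left; exists j, i; split; first by lia.
  by move=> l; rewrite opprK !ffunE addrC.
Qed.

End Height.

(** * The module generated by a highest weight vector *)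

Section HighestWeight.
Context {C : numClosedFieldType} {n d : nat}.
Variable rho : 'M[C]_(n.*2.+1) -> 'M[C]_d.
Hypothesis rep : is_rep C n d rho.
Hypothesis irr : irreducible_rep C n d rho.
Local Notation N := (n.*2.+1).
Local Notation act := (act rho).
Local Notation Mroot := (Mroot rho).
Implicit Types (a b c : 'I_N) (i : 'I_n) (j : nat) (X Y : 'M[C]_N) (z : {ffun 'I_n -> int})
  (u w : 'rV[C]_d).

Lemma highest_killed (v : 'cV[C]_d) a b :
  (forall al X, posroot n al -> rootvec C n al X -> rho X *m v = 0) ->
  ht (wt b) < ht (wt a) -> v^T *m Mroot a b = 0.
Proof.
move=> kill lt; have [<-|ne] := eqVneq (bar a) b.
  by rewrite (Mroot_bar0 _ rep) mulmx0.
rewrite -trmx_mul (kill (wt a - wt b)) ?trmx0 //; first exact: posroot_wt.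
by split=> [|i]; [exact: Xroot_so | exact: Hcart_comm].
Qed.

Variables (v0 : 'rV[C]_d) (zl : {ffun 'I_n -> int}).
Hypothesis v0_neq0 : v0 != 0.
Hypothesis v0_weight : weight_vector rho v0 zl.
Hypothesis v0_killed : forall a b, ht (wt b) < ht (wt a) -> v0 *m Mroot a b = 0.

Definition lowering a b := ht (wt a) < ht (wt b).

(** The filtration of the module generated by [v0] under the negative root vectors, by the number of
    factors. *)
Fixpoint lowered j : 'M[C]_d :=
  if j is j'.+1 then
    (lowered j' + \sum_(p : 'I_N * 'I_N | lowering p.1 p.2)
       lowered j' *m Mroot p.1 p.2)%MS
  else <<v0>>%MS.

Lemma lowered_step j a b : lowering a b -> (lowered j *m Mroot a b <= lowered j.+1)%MS.
Proof.
move=> low; apply: submx_trans (addsmxSr _ _).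
exact: (sumsmx_sup (a, b)).
Qed.

Lemma lowered_act j X :
  (forall a b, ~~ lowering a b -> (lowered j *m Mroot a b <= lowered j)%MS) ->
  so_mem C n X -> (lowered j *m act X <= lowered j.+1)%MS.
Proof.
move=> upper soX; rewrite (act_decomp _ rep X soX) mulmx_sumr; apply: summx_sub => p _.
rewrite -scalemxAr; apply: scalemx_sub.
have [low|nlow] := boolP (lowering p.1 p.2); first exact: lowered_step.
exact: submx_trans (upper _ _ nlow) (addsmxSl _ _).
Qed.

(** An upper operator is commuted past the last lowering operator. The induction hypothesis handles
    the product in the new order, and the commutator lies in the Lie algebra, so [lowered_act] at
    the previous stage handles it. *)
Lemma lowered_borel j a b : ~~ lowering a b -> (lowered j *m Mroot a b <= lowered j)%MS.
Proof.
elim: j a b => [|j IH] a b nlow.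
  rewrite /= (eqmxMr _ (genmxE v0)) genmxE; move: nlow; rewrite /lowering -leNgt le_eqVlt.
  case/orP=> [/eqP/ht_wt_inj <-|lt].
    by rewrite (weight_diag _ rep _ _ _ _ v0_weight) scalemx_sub.
  by rewrite v0_killed // sub0mx.
rewrite [X in (X *m _ <= _)%MS]/= addsmxMr addsmx_sub; apply/andP; split.
  exact: submx_trans (IH _ _ nlow) (addsmxSl _ _).
rewrite sumsmxMr; apply/sumsmx_subP => -[c e] /= low.
have so1 := Xroot_so (C := C) a b; have so2 := Xroot_so (C := C) c e.
have /eqP := act_comm _ rep _ _ so1 so2.
rewrite eq_sym subr_eq addrC => /eqP E.
rewrite -mulmxA [Mroot c e *m _]E mulmxDr; apply: addmx_sub.
  by rewrite mulmxA (submx_trans (submxMr _ (IH _ _ nlow))) // lowered_step.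
by apply: lowered_act => //; exact: so_mem_comm.
Qed.

(** Otherwise the rank would grow at every stage and exceed d. *)
Lemma lowered_stable : exists j, (lowered j.+1 <= lowered j)%MS.
Proof.
suff H j : (exists i : nat, (lowered i.+1 <= lowered i)%MS) \/ (j <= \rank (lowered j))%N.
  by case: (H d.+1) => // le; have := leq_trans le (rank_leq_row _); rewrite ltnn.
elim: j => [|j [IH|IH]]; [by right | by left |].
have [st|nst] := boolP (lowered j.+1 <= lowered j)%MS; [by left; exists j|right].
apply: leq_ltn_trans IH _.
by apply: rank_ltmx; rewrite ltmxE addsmxSl.
Qed.

Lemma v0_lowered j : (v0 <= lowered j)%MS.
Proof.
elim: j => [|j IH]; first by rewrite /= genmxE.
exact: submx_trans IH (addsmxSl _ _).
Qed.

(** A stage where the filtration stops growing is an invariant subspace containing [v0], so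
    irreducibility makes it everything. *)
Lemma lowered_full : exists j, row_full (lowered j).
Proof.
have [j st] := lowered_stable; exists j.
case: (irr (lowered j)) => // [X soX|j0].
  apply: submx_trans st; apply: lowered_act soX => a b; exact: lowered_borel.
by have := v0_lowered j; rewrite j0 submx0 (negbTE v0_neq0).
Qed.

(** The strict bound on the height separates these weights from the highest one; the bound on the
    coordinate sum limits the support of the multiplicities. *)
Definition below z := ht z < ht zl /\ wtotal z <= wtotal zl.

Definition weight_sum u := exists2 s : seq ('rV[C]_d * {ffun 'I_n -> int}),
  forall x, x \in s -> weight_vector rho x.1 x.2 /\ below x.2 & u = \sum_(x <- s) x.1.

Lemma weight_sum0 : weight_sum 0.
Proof. by exists [::] => //; rewrite big_nil. Qed.

Lemma weight_sumD u w : weight_sum u -> weight_sum w -> weight_sum (u + w).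
Proof.
move=> [s Ps ->] [t Pt ->]; exists (s ++ t); last by rewrite big_cat.
by move=> x; rewrite mem_cat => /orP[/Ps|/Pt].
Qed.

Lemma weight_sum1 u z : weight_vector rho u z -> below z -> weight_sum u.
Proof.
move=> uz bz; exists [:: (u, z)]; last by rewrite big_seq1.
by move=> x; rewrite inE => /eqP ->.
Qed.

Lemma below_lowering z a b : lowering a b -> ht z <= ht zl -> wtotal z <= wtotal zl ->
  below (z + (wt a - wt b)).
Proof.
move=> low le1 le2; have := ht_total_wt _ _ low; move: low.
by rewrite /lowering /below !(htD, htN, wtotalD, wtotalN) => ? ?; split; lia.
Qed.

Lemma weight_vectorZ (x : C) u z : weight_vector rho u z -> weight_vector rho (x *: u) z.
Proof. by move=> uz i; rewrite -scalemxAl uz !scalerA mulrC. Qed.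

Lemma weight_sum_lowering u a b :
  lowering a b -> weight_sum u -> weight_sum (u *m Mroot a b).
Proof.
move=> low [s Ps ->].
exists [seq (x.1 *m Mroot a b, x.2 + (wt a - wt b)) | x <- s]; last first.
  by rewrite big_map mulmx_suml.
move=> _ /mapP[x /Ps[xw [lt le]] ->]; split; first exact: weight_shift.
by apply: below_lowering => //; apply: ltW.
Qed.

Lemma lowered_weights j u : (u <= lowered j)%MS ->
  exists x, weight_sum (u - x *: v0).
Proof.
elim: j u => [|j IH] u; rewrite [lowered _]/=.
  by rewrite genmxE => /sub_rVP[x ->]; exists x; rewrite subrr; apply: weight_sum0.
move=> /sub_addsmxP[[u1 u2] -> /=].
have [x wx] := IH _ (submxMl u1 (lowered j)); exists x.
rewrite addrAC; apply: weight_sumD => //.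
have /sub_sumsmxP[w_ ->] := submxMl u2 (\sum_(p : 'I_N * 'I_N | lowering p.1 p.2)
  lowered j *m Mroot p.1 p.2)%MS.
apply: (big_ind weight_sum) => [|u' w'|[a b] /= low];
  [exact: weight_sum0 | exact: weight_sumD |].
have [y wy] := IH _ (submxMl (w_ (a, b)) (lowered j)).
rewrite mulmxA -[X in X *m _](subrK (y *: v0)) mulmxDl; apply: weight_sumD.
  exact: weight_sum_lowering.
apply: (weight_sum1 _ (zl + (wt a - wt b))); last exact: below_lowering.
by apply: weight_shift => //; apply: weight_vectorZ.
Qed.

Lemma weight_sum_total u : exists x, weight_sum (u - x *: v0).
Proof.
have [j full] := lowered_full; apply: (lowered_weights j).
exact: submx_full.
Qed.

(** If [x] differs from the first weight in coordinate i, subtracting that weight from the action of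
    H_i kills the first summand, rescales the others and keeps [u] up to a nonzero factor; induction
    on the length applies. The scalars [x] are arbitrary, so integral weights are covered too. *)
Lemma weight_sum_indep (s : seq ('rV[C]_d * {ffun 'I_n -> int})) u (x : 'I_n -> C) :
  (forall y, y \in s -> weight_vector rho y.1 y.2) ->
  (forall i, u *m act (Hcart C n i) = x i *: u) ->
  u = \sum_(y <- s) y.1 -> u != 0 ->
  exists2 y, y \in s & forall i, x i = chi y.2 i.
Proof.
have [m] := ubnP (size s); elim: m s u => // m IH [|y s] u /= lts sw ux.
  by rewrite big_nil => ->; rewrite eqxx.
rewrite big_cons => uE u0.
have [/forallP yx|] := boolP [forall i, x i == chi y.2 i].
  by exists y => [|i]; [exact: mem_head | exact/eqP].
rewrite negb_forall => /existsP[i ne].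
pose D := act (Hcart C n i) - (chi y.2 i)%:M.
have uD : u *m D = (x i - chi y.2 i) *: u by rewrite mulmxBr ux mul_mx_scalar scalerBl.
have wD (t : 'rV_d) z : weight_vector rho t z -> t *m D = (chi z i - chi y.2 i) *: t.
  by move=> tz; rewrite mulmxBr tz mul_mx_scalar scalerBl.
have sw' y' : y' \in s -> weight_vector rho y'.1 y'.2.
  by move=> ys; apply: sw; rewrite inE ys orbT.
have [] := IH [seq ((chi y'.2 i - chi y.2 i) *: y'.1, y'.2) | y' <- s] (u *m D).
- by rewrite size_map.
- by move=> _ /mapP[y' ys ->] /=; apply/weight_vectorZ/sw'.
- by move=> l; rewrite uD -scalemxAl ux !scalerA mulrC.
- rewrite uE mulmxDl (wD _ _ (sw y (mem_head _ _))) subrr scale0r add0r.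
  rewrite mulmx_suml big_map big_seq [RHS]big_seq.
  by apply: eq_bigr => y' /sw' /wD.
- by rewrite uD scaler_eq0 negb_or u0 subr_eq0 ne.
by move=> _ /mapP[y' ys ->] /= E; exists y' => //; rewrite inE ys orbT.
Qed.

Lemma weight_in_support u (x : 'I_n -> C) : u != 0 ->
  (forall i, u *m act (Hcart C n i) = x i *: u) ->
  exists2 z, z = zl \/ below z & forall i, x i = chi z i.
Proof.
move=> u0 ux; have [c [s Ps us]] := weight_sum_total u.
have [] := weight_sum_indep ((c *: v0, zl) :: s) u x _ ux _ u0.
- move=> y; rewrite inE => /orP[/eqP-> /=|/Ps[]//].
  exact: weight_vectorZ.
- by rewrite big_cons -us addrC subrK.
move=> y; rewrite inE => /orP[/eqP->|/Ps[_ yb]] xy.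
  by exists zl; first by left.
by exists y.2; first by right.
Qed.

Lemma chi_inj z z' : (forall i, chi z i = chi z' i :> C) -> z = z'.
Proof. by move=> E; apply/ffunP => i; have /addIr/intr_inj := E i. Qed.

Lemma rank_wspace_highest : \rank (wspace rho zl) = 1%N.
Proof.
suff E : (wspace rho zl :=: v0)%MS by rewrite E rank_rV v0_neq0.
apply/eqmxP; apply/andP; split; last by apply/sub_wspace.
apply/rV_subP => u /sub_wspace uz; have [c [s Ps us]] := weight_sum_total u.
have [/eqP|nz] := eqVneq (u - c *: v0) 0.
  by rewrite subr_eq0 => /eqP ->; apply: scalemx_sub.
have [] := weight_sum_indep s _ (chi zl) (fun y ys => (Ps y ys).1) _ us nz.
  by move=> i; rewrite mulmxBl uz -scalemxAl v0_weight scalerBr !scalerA mulrC.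
by move=> y /Ps[_ [lt _]] /chi_inj E; move: lt; rewrite -E ltxx.
Qed.

Lemma rank_wspace_eq0 z : z <> zl -> ~ below z -> \rank (wspace rho z) = 0%N.
Proof.
move=> nzl nb; apply/eqP; rewrite mxrank_eq0 -submx0; apply/rV_subP => u /sub_wspace uz.
have [->|nz] := eqVneq u 0; first by rewrite sub0mx.
have [z' [->|bz']] := weight_in_support u _ nz uz; move/chi_inj => E; first by case: nzl.
by case: nb; rewrite E.
Qed.

(** Schur's argument: the eigenspace is invariant because the Casimir element is central, and it
    contains [v0]. *)
Lemma casimir_scalar (x : C) : v0 *m casimir rho = x *: v0 -> casimir rho = x%:M.
Proof.
move=> v0x; set K := kermx (casimir rho - x%:M).
have v0K : (v0 <= K)%MS by rewrite sub_kermx mulmxBr v0x mul_mx_scalar subrr.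
case: (irr K) => [X soX|K0|].
- rewrite -/(act X) sub_kermx -mulmxA mulmxBr -(casimir_central _ rep X soX).
  by rewrite mul_mx_scalar -mul_scalar_mx -mulmxBl mulmxA mulmx_ker mul0mx.
- by move: v0K; rewrite K0 submx0 (negbTE v0_neq0).
move=> full; apply/eqP; rewrite -subr_eq0.
have : (1%:M <= K)%MS by apply: submx_full.
by rewrite sub_kermx mul1mx.
Qed.

(** * Traces along root strings and Freudenthal's formula *)

Definition mult z : nat := \rank (wspace rho z).

(* Rows are acted on from the right, so this is the trace of the operator
   [Xroot b a] after [Xroot a b]. *)
Definition string_trace a b z : C :=
  subtrace (wspace rho z) (Mroot a b *m Mroot b a).

Lemma string_trace_opp a b z : bar a != b ->
  string_trace b a z = string_trace a b z + (diag_wt z a - diag_wt z b) * (mult z)%:R.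
Proof.
move=> ne; rewrite -(subtrace_scalar (wspace rho z)
  (Mroot b a *m Mroot a b - Mroot a b *m Mroot b a)).
  by rewrite -subtraceD addrC subrK.
by apply: weight_opp => //; apply: weight_wspace.
Qed.

Lemma string_trace_shift a b z :
  string_trace a b z = string_trace b a (z + (wt a - wt b)).
Proof.
apply: subtrace_cyclic; first exact: wspace_shift.
have := wspace_shift _ rep (z + (wt a - wt b)) b a.
by rewrite -addrA -[wt b - wt a]opprB subrr addr0.
Qed.

(** Cyclicity of the trace moves it to the next weight of the string, and the commutator restores
    the order of the factors. Iteration telescopes until a weight of multiplicity 0 is reached. *)
Lemma string_trace_rec a b z (z' := z + (wt a - wt b)) : bar a != b ->
  string_trace a b z =
  string_trace a b z' + (diag_wt z' a - diag_wt z' b) * (mult z')%:R.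
Proof. by move=> ne; rewrite string_trace_shift string_trace_opp. Qed.

Lemma string_trace_eq0 a b z : mult (z + (wt a - wt b)) = 0%N -> string_trace a b z = 0.
Proof. by move=> m0; rewrite string_trace_shift; apply: subtrace_rank0. Qed.

(** With mu the weight encoded by [z] and delta half the sum of the positive roots, this is (mu, mu
    + 2 delta), as 2 delta = (2n - 1, 2n - 3, ..., 1). *)
Definition cas_value z : C :=
  \sum_i chi z i ^+ 2 + \sum_(i < n) \sum_(j < n | (i < j)%N) chi z i *+ 2 + \sum_i chi z i.

Definition string_sum z : C :=
  \sum_(i < n) \sum_(j < n | (i < j)%N)
     (string_trace (pidx i) (pidx j) z + string_trace (pidx i) (nidx j) z) +
  \sum_i string_trace (pidx i) ord0 z.

(** Reordering the factors for each negative root yields the trace for the positive root once more,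
    plus a scalar. These scalars and the Cartan part form [cas_value]; the outer factor 2 comes from
    [sum_index_pairs]. *)
Lemma casimir_trace z : subtrace (wspace rho z) (casimir rho) =
  (cas_value z * (mult z)%:R + string_sum z *+ 2) *+ 2.
Proof.
rewrite /casimir subtrace_sum; under eq_bigr => a _ do rewrite subtrace_sum.
rewrite (sum_index_pairs (fun a b => string_trace a b z)); last first.
- by move=> a; rewrite /string_trace (Mroot_bar0 _ rep) mul0mx subtrace0.
- by move=> a b; rewrite /string_trace !(Mroot_bar _ rep) mulNmx mulmxN opprK.
congr (_ *+ 2); set m := (mult z)%:R.
have -> : \sum_i string_trace (pidx i) (pidx i) z = (\sum_i chi z i ^+ 2) * m.
  rewrite mulr_suml; apply: eq_bigr => i _; apply: subtrace_scalar.
  have E := weight_diag _ rep _ _ _ (pidx i) (weight_wspace rho z).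
  by rewrite mulmxA E -scalemxAl E diag_wtE scalerA.
have E0 i : string_trace (pidx i) ord0 z + string_trace ord0 (pidx i) z =
    string_trace (pidx i) ord0 z *+ 2 + chi z i * m.
  by rewrite [string_trace ord0 _ _]string_trace_opp ?barE // !diag_wtE subr0 addrA.
have E1 (i j : 'I_n) : (i < j)%N ->
    string_trace (pidx i) (pidx j) z + string_trace (pidx j) (pidx i) z +
    (string_trace (pidx i) (nidx j) z + string_trace (nidx j) (pidx i) z) =
    (string_trace (pidx i) (pidx j) z + string_trace (pidx i) (nidx j) z) *+ 2 +
    chi z i *+ 2 * m.
  move=> lt; rewrite [string_trace (pidx j) _ _]string_trace_opp ?barE ?idxE //.
  rewrite [string_trace (nidx j) _ _]string_trace_opp ?barE ?idxE //; last first.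
    by apply/eqP => ij; rewrite ij ltnn in lt.
  by rewrite !diag_wtE -/m; ring.
rewrite (eq_bigr _ (fun i _ => E0 i)) big_split /=.
have -> : \sum_(i < n) \sum_(j < n | (i < j)%N)
   (string_trace (pidx i) (pidx j) z + string_trace (pidx j) (pidx i) z +
      (string_trace (pidx i) (nidx j) z + string_trace (nidx j) (pidx i) z)) =
   (\sum_(i < n) \sum_(j < n | (i < j)%N)
     (string_trace (pidx i) (pidx j) z + string_trace (pidx i) (nidx j) z)) *+ 2 +
   (\sum_(i < n) \sum_(j < n | (i < j)%N) chi z i *+ 2) * m.
  rewrite -sumrMnl mulr_suml -big_split /=; apply: eq_bigr => i _.
  rewrite -sumrMnl mulr_suml -big_split /=; apply: eq_bigr => j; exact: E1.
rewrite -mulr_suml sumrMnl /cas_value /string_sum -/m.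
by ring.
Qed.

Lemma string_trace_highest a b : lowering b a -> string_trace a b zl = 0.
Proof.
move=> pos; apply: string_trace_eq0; apply: rank_wspace_eq0.
  move/(congr1 ht); rewrite htD htD htN; move: pos; rewrite /lowering; lia.
move=> [+ _]; rewrite htD htD htN; move: pos; rewrite /lowering; lia.
Qed.

Lemma string_sum_highest : string_sum zl = 0.
Proof.
rewrite /string_sum big1 ?add0r => [|i _]; last first.
  apply: big1 => j lt; have lti := ltn_ord i; have ltj := ltn_ord j.
  rewrite !string_trace_highest ?addr0 // /lowering !wtE !htE; lia.
apply: big1 => i _; have lti := ltn_ord i.
by rewrite string_trace_highest // /lowering !wtE !htE; lia.
Qed.

(** The Casimir element preserves the one-dimensional highest weight space. Its eigenvalue is read
    off the trace formula there, where all string traces vanish. *)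
Lemma casimir_eq : casimir rho = (cas_value zl *+ 2)%:M.
Proof.
have : (v0 *m casimir rho <= wspace rho zl)%MS.
  apply/sub_wspace => i; rewrite -mulmxA casimir_central //; last exact: Hcart_so.
  by rewrite mulmxA v0_weight scalemxAl.
have v0z : (v0 <= wspace rho zl)%MS by apply/sub_wspace.
have : (wspace rho zl <= v0)%MS.
  by rewrite -(geq_leqif (mxrank_leqif_sup v0z)) rank_wspace_highest rank_rV v0_neq0.
move=> le1 le2; have /sub_rVP[x v0x] := submx_trans le2 le1.
rewrite (casimir_scalar _ v0x); congr (_%:M).
have := casimir_trace zl; rewrite string_sum_highest mul0rn addr0.
rewrite (subtrace_scalar _ _ x) /mult ?rank_wspace_highest ?mulr1 //.
by rewrite (casimir_scalar _ v0x) mul_mx_scalar.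
Qed.

Theorem freudenthal z :
  cas_value zl * (mult z)%:R = cas_value z * (mult z)%:R + string_sum z *+ 2.
Proof.
have := casimir_trace z; rewrite (subtrace_scalar _ _ (cas_value zl *+ 2)).
  by rewrite mulrnAl => /(@pmulrnI C 2) ->.
by rewrite casimir_eq mul_mx_scalar.
Qed.

End HighestWeight.

(** * Sign changes and binomial sums *)

(* [absn x + 1/2] is the absolute value of [x + 1/2]. *)
Definition absn (x : int) : nat := match x with Posz q => q | Negz q => q end.

Section Norm.
Context {n : nat}.
Implicit Types (i j : 'I_n) (z : {ffun 'I_n -> int}).

Definition norm z : nat := \sum_(i < n) absn (z i).
Definition absz_ffun z : {ffun 'I_n -> int} := [ffun i => Posz (absn (z i))].
(** The reflection in the short root eps_i: negating z_i + 1/2 sends z_i to -1 - z_i. *)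
Definition refl i z : {ffun 'I_n -> int} := [ffun l => if l == i then -1 - z l else z l].

Lemma reflK i : involutive (refl i).
Proof. by move=> z; apply/ffunP => l; rewrite !ffunE; case: eqP => // _; ring. Qed.

Lemma absn_refl (x : int) : absn (-1 - x) = absn x.
Proof.
by case: x => q; [have -> : -1 - q%:Z = Negz q by lia | have -> : -1 - Negz q = Posz q by lia].
Qed.

Lemma absz_ffun_refl i z : absz_ffun (refl i z) = absz_ffun z.
Proof.
by apply/ffunP => l; rewrite !ffunE; case: eqP => // _; rewrite absn_refl.
Qed.

Lemma norm_absz z : norm (absz_ffun z) = norm z.
Proof. by apply: eq_bigr => i _; rewrite ffunE. Qed.

Lemma wtotal_absz z : wtotal (absz_ffun z) = norm z.
Proof. by rewrite /wtotal /norm -natz natr_sum; apply: eq_bigr => i _; rewrite ffunE natz. Qed.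

Lemma absz_ffun_id z : (forall i, 0 <= z i) -> absz_ffun z = z.
Proof. by move=> z0; apply/ffunP => i; rewrite ffunE; case: (z i) (z0 i). Qed.

Lemma ht_absz z : ht z <= ht (absz_ffun z).
Proof.
apply: ler_sum => i _; apply: ler_wpM2l => //; rewrite ffunE.
by case: (z i) => q /=; lia.
Qed.

Lemma ht_norm z : ht z <= (n * norm z)%N%:Z.
Proof.
apply: le_trans (ht_absz z) _; rewrite /norm big_distrr /= -natz natr_sum.
apply: ler_sum => i _; rewrite natz PoszM ffunE; apply: ler_wpM2r => //.
by rewrite lez_nat leq_subr.
Qed.

Lemma norm_update i z z' : (forall l, l != i -> z' l = z l) ->
  (norm z' + absn (z i) = norm z + absn (z' i))%N.
Proof.
move=> zz'; rewrite /norm (bigD1 i) //= [in RHS](bigD1 i) //=.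
rewrite (eq_bigr (fun l => absn (z l))) => [|l ne]; last by rewrite zz'.
by move: (\sum_(l < n | l != i) _)%N => S;
  rewrite addnAC [RHS]addnAC [(absn (z i) + _)%N]addnC.
Qed.

Lemma eps_id i : eps i i = 1. Proof. by rewrite ffunE eqxx. Qed.
Lemma eps_neq i l : l != i -> eps i l = 0.
Proof. by rewrite ffunE eq_sym => /negbTE ->. Qed.

Lemma norm_addr i z : (norm (z + eps i)%R + absn (z i) = norm z + absn (z i + 1)%R)%N.
Proof.
have -> : z i + 1 = (z + eps i) i by rewrite ffunE eps_id.
by apply: norm_update => l ne; rewrite ffunE eps_neq ?addr0.
Qed.

Lemma norm_subr i z : (norm (z - eps i)%R + absn (z i) = norm z + absn (z i - 1)%R)%N.
Proof.
have -> : z i - 1 = (z - eps i) i by rewrite !ffunE eqxx.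
by apply: norm_update => l ne; rewrite 2!ffunE eps_neq ?subr0.
Qed.

End Norm.

(** * Closed forms for binomial sums *)

Section Binomials.
Context {C : numClosedFieldType}.
Variable n : nat.
Hypothesis n_gt0 : (0 < n)%N.

(** For n > 0, the number of monomials of degree s in n variables. *)
Definition multichoose s : nat := 'C(s + n.-1, s).

Lemma multichooseS s :
  s.+1%:R * (multichoose s.+1)%:R = (s%:R + n%:R) * (multichoose s)%:R :> C.
Proof.
rewrite -natrD -!natrM /multichoose; congr (_%:R).
have -> : (s.+1 + n.-1 = s + n)%N by lia.
by rewrite -mul_bin_diag; congr (_ * 'C(_, _))%N; lia.
Qed.

(* The sum over [1 <= u <= s] of [(x + u) * multichoose (s - u)], restricted to
   the [u] that are odd if [odd] is true and even otherwise. *)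
Fixpoint parity_sum (odd : bool) (x : C) s : C :=
  if s is s'.+1 then
    (if odd then (x + 1) * (multichoose s')%:R else 0) + parity_sum (~~ odd) (x + 1) s'
  else 0.

(** The closed form of the sum of (x + u) [multichoose (s - u)] over all u from 1 to s; [full_sumS]
    is the recursion that identifies it. *)
Definition full_sum (x : C) s : C :=
  s%:R * (multichoose s)%:R * ((n%:R + 1) * x + s%:R + n%:R) / (n%:R * (n%:R + 1)).

Lemma full_sumS x s : full_sum x s.+1 = (x + 1) * (multichoose s)%:R + full_sum (x + 1) s.
Proof.
have nz : n%:R != 0 :> C by rewrite pnatr_eq0 -lt0n.
have nz1 : n%:R + 1 != 0 :> C by rewrite natr1 pnatr_eq0.
rewrite /full_sum multichooseS -natr1; field.
by rewrite nz nz1.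
Qed.

Lemma parity_sum_full x s : parity_sum true x s + parity_sum false x s = full_sum x s.
Proof.
elim: s x => [|s IH] x; first by rewrite /= addr0 /full_sum !mul0r.
by rewrite full_sumS -IH /=; ring.
Qed.

End Binomials.

(** * Invariance of multiplicities under sign changes *)

Section Reflections.
Context {C : numClosedFieldType} {n d : nat}.
Variable rho : 'M[C]_(n.*2.+1) -> 'M[C]_d.
Hypothesis rep : is_rep C n d rho.
Local Notation mult := (mult rho).
Local Notation Mroot := (Mroot rho).
Implicit Types (i j : 'I_n) (z : {ffun 'I_n -> int}).

Lemma weight_shift_pow (u : 'M[C]_d) z a b p : weight_vector rho u z ->
  weight_vector rho (u *m mxpow (Mroot a b) p) (z + (wt a - wt b) *+ p).
Proof.
move=> uz; elim: p => [|p IH]; first by rewrite /mxpow /= mulmx1 mulr0n addr0.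
by rewrite mxpowSr mulmxA mulrSr addrA; apply: weight_shift.
Qed.

(** The i-th coordinate of the weight is plus or minus (2q + 1)/2. The power 2q + 1 of the short
    root vector pointing towards the opposite sign maps the weight space injectively into the
    reflected one. *)
Lemma mult_refl_le i z : (mult z <= mult (refl i z))%N.
Proof.
pose e := Mroot (pidx i) ord0; pose f := Mroot ord0 (pidx i).
pose h := act rho (Hcart C n i).
have efh : f *m e - e *m f = h.
  have m00 : Mroot ord0 ord0 = 0 by have := Mroot_bar0 _ rep ord0; rewrite bar0.
  by rewrite /e /f (Mroot_opp _ rep) ?barE // m00 subr0 /h act_Hcart.
have eh : e *m h - h *m e = e.
  by rewrite (Mroot_cartan _ rep) !wtE subr0 ffunE eqxx scale1r.
have fh : f *m h - h *m f = - f.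
  by rewrite (Mroot_cartan _ rep) !wtE sub0r !ffunE eqxx scaleN1r.
have Wh := weight_wspace rho z i; rewrite -/h in Wh.
case E : (z i) => [q|q].
- have W' : wspace rho z *m (- h) = - (q.*2.+1%:R / 2) *: wspace rho z.
    rewrite mulmxN Wh -scaleNr; congr (_ *: _); rewrite /chi E -muln2.
    rewrite -[(q * 2).+1%:R]natr1 natrM.
    by rewrite -pmulrn; field.
  (* For a positive coordinate the triple (f, e, -h) is used: it satisfies the same relations and
     makes the weight negative. *)
  rewrite /mult -(sl2_rank_pow f e (- h) _ _ _ _ _ W').
  + apply: mxrankS; apply/sub_wspace.
    suff -> : refl i z = z + (wt ord0 - wt (pidx i)) *+ q.*2.+1.
      exact/weight_shift_pow/weight_wspace.
    apply/ffunP => l; rewrite !wtE sub0r !ffunE ffunMnE !ffunE [i == l]eq_sym.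
    by case: eqP => [->|_]; rewrite ?E /=; lia.
  + by rewrite -efh opprB.
  + by rewrite mulmxN mulNmx -opprD fh opprK.
  + by rewrite mulmxN mulNmx -opprD eh.
have W' : wspace rho z *m h = - (q.*2.+1%:R / 2) *: wspace rho z.
  rewrite Wh; congr (_ *: _); rewrite /chi E -muln2 -[(q * 2).+1%:R]natr1 natrM NegzE.
  by rewrite rmorphN /= -pmulrn -[q.+1%:R]natr1; field.
rewrite /mult -(sl2_rank_pow e f h efh eh fh _ _ W').
apply: mxrankS; apply/sub_wspace.
suff -> : refl i z = z + (wt (pidx i) - wt ord0) *+ q.*2.+1.
  exact/weight_shift_pow/weight_wspace.
apply/ffunP => l; rewrite !wtE subr0 !ffunE ffunMnE !ffunE [i == l]eq_sym.
by case: eqP => [->|_]; rewrite ?E /=; lia.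
Qed.

Lemma mult_refl i z : mult (refl i z) = mult z.
Proof.
apply/eqP; rewrite eqn_leq mult_refl_le andbT.
by rewrite -{2}(reflK i z) mult_refl_le.
Qed.

Lemma mult_absz z : mult (absz_ffun z) = mult z.
Proof.
have [m] := ubnP #|[set i | z i < 0]|; elim: m z => // m IH z ltm.
have [/existsP[i zi]|] := boolP [exists i, z i < 0]; last first.
  rewrite negb_exists => /forallP z0; rewrite absz_ffun_id // => i.
  by rewrite leNgt z0.
rewrite -(mult_refl i z) -(absz_ffun_refl i z); apply: IH.
apply: leq_trans (ltm : (_ <= m)%N); apply: proper_card; apply/properP; split.
  apply/subsetP => l; rewrite !inE ffunE; case: eqP => [->|//]; lia.
by exists i; rewrite inE // ffunE eqxx; lia.
Qed.

End Reflections.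

(** * Solving the recursion *)

Section Multiplicities.
Context {C : numClosedFieldType} {n d : nat}.
Variables (rho : 'M[C]_(n.*2.+1) -> 'M[C]_d) (k : nat).
Hypothesis n_gt0 : (0 < n)%N.
Hypothesis rep : is_rep C n d rho.
Hypothesis irr : irreducible_rep C n d rho.
Local Notation mult := (mult rho).
Local Notation strace := (string_trace rho).
Local Notation B := (multichoose n).
Local Notation psum := (@parity_sum C n).
Local Notation fsum := (@full_sum C n).
Implicit Types (i j : 'I_n) (z : {ffun 'I_n -> int}).

Definition zlam : {ffun 'I_n -> int} := [ffun i : 'I_n => if (i : nat) == 0%N then k%:Z else 0].

Variable v0 : 'rV[C]_d.
Hypothesis v0_neq0 : v0 != 0.
Hypothesis v0_weight : weight_vector rho v0 zlam.
Hypothesis v0_killed : forall a b, ht (wt b) < ht (wt a) -> v0 *m Mroot rho a b = 0.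

Definition expected z : nat := if (norm z <= k)%N then B (k - norm z) else 0%N.

Lemma expectedE z s : (norm z + s = k)%N -> expected z = B s.
Proof. by rewrite /expected => <-; rewrite leq_addr addKn. Qed.

Lemma expected_eq0 z : (k < norm z)%N -> expected z = 0%N.
Proof. by rewrite /expected ltnNge => /negbTE ->. Qed.

Lemma wtotal_zlam : wtotal zlam = k.
Proof.
rewrite /wtotal (bigD1 (Ordinal n_gt0)) //= big1 ?ffunE ?addr0 // => i ne.
by rewrite ffunE ifF //; apply: contra_neqF ne => /eqP i0; apply: ord_inj.
Qed.

(** After sign changes the coordinate sum equals the norm, which then exceeds the coordinate sum k
    of the highest weight. *)
Lemma mult_support z : (k < norm z)%N -> mult z = 0%N.
Proof.
move=> lt; rewrite -(mult_absz _ rep).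
apply: (rank_wspace_eq0 _ rep irr v0 zlam) => //.
  move/(congr1 wtotal); rewrite wtotal_absz wtotal_zlam; lia.
by move=> [_]; rewrite wtotal_absz wtotal_zlam; lia.
Qed.

(** * String traces when the multiplicities are known above a given height *)

Section Step.
Variable z0 : {ffun 'I_n -> int}.
Hypothesis known : forall z, ht z0 < ht z -> mult z = expected z.

(** Each step of the string raises the norm by 1, so every u from 1 to s contributes. *)
Lemma strace_short i z s : ht z0 <= ht z -> 0 <= z i -> (norm z + s = k)%N ->
  strace (pidx i) ord0 z = fsum (chi z i) s.
Proof.
elim: s z => [|s IH] z hz zi nz.
all: have lti := ltn_ord i.
all: have hz' : ht z < ht (z + (wt (pidx i) - wt ord0)) by rewrite htD !wtE subr0 ht_eps; lia.
all: have hz0 := le_lt_trans hz hz'.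
all: have nz' : norm (z + (wt (pidx i) - wt ord0)) = (norm z).+1
  by rewrite !wtE subr0; have := norm_addr i z; case: (z i) zi => // q _ /=; lia.
  rewrite string_trace_eq0 ?known ?expected_eq0 ?nz' //; last by lia.
  by rewrite /full_sum !mul0r.
rewrite (string_trace_rec _ rep) ?barE // known //.
rewrite (expectedE _ s); last by rewrite nz'; lia.
have ci : chi (z + (wt (pidx i) - wt ord0)) i = chi z i + 1 :> C.
  by rewrite /chi !wtE subr0 ffunE eps_id rmorphD /=; ring.
rewrite IH ?nz'; [| exact: ltW | | by lia].
  by rewrite !diag_wtE ci full_sumS // subr0 addrC.
by rewrite !wtE subr0 ffunE eps_id addr_ge0.
Qed.

(** Each step raises both the norm and the weight factor by 2, so exactly the even u contribute. *)
Lemma strace_plus i j z s : i != j -> ht z0 <= ht z -> 0 <= z i -> 0 <= z j ->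
  (norm z + s = k)%N ->
  strace (pidx i) (nidx j) z = psum false (chi z i + chi z j) s.
Proof.
move=> ij; have [m] := ubnP s; elim: m s z => // m IH s z lts hz zi zj nz.
have lti := ltn_ord i; have ltj := ltn_ord j.
have z'E : z + (wt (pidx i) - wt (nidx j)) = z + eps i + eps j by rewrite !wtE opprK addrA.
have zi' : (z + eps i + eps j) i = z i + 1 by rewrite !ffunE eqxx eq_sym (negbTE ij) addr0.
have zj' : (z + eps i + eps j) j = z j + 1 by rewrite !ffunE eqxx (negbTE ij) addr0.
have hz' : ht z < ht (z + eps i + eps j) by rewrite !htD !ht_eps; lia.
have hz0 := le_lt_trans hz hz'.
have nz' : norm (z + eps i + eps j) = (norm z).+2.
  have := norm_addr i z; have := norm_addr j (z + eps i).
  rewrite [(z + eps i) j]ffunE eps_neq 1?eq_sym // addr0.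
  by case: (z i) zi => // q _; case: (z j) zj => // r _ /=; lia.
case: s nz lts => [|[|s]] nz lts.
1,2: rewrite string_trace_eq0 ?z'E ?known ?expected_eq0 ?nz' //=; try lia;
  by rewrite ?addr0.
rewrite (string_trace_rec _ rep) ?barE ?idxE // z'E known //.
rewrite (expectedE _ s); last by rewrite nz'; lia.
rewrite (IH s) ?zi' ?zj' ?nz'; [|lia|exact: ltW|lia|lia|lia].
rewrite !diag_wtE /chi zi' zj' !rmorphD /= add0r addrC.
by congr (_ * _ + psum false _ s); ring.
Qed.

(** With z_j negative, subtracting eps_j moves that coordinate away from 0, so the string behaves as
    in [strace_plus], with the sign of the j-th coordinate changed. *)
Lemma strace_minus_neg i j z s q : (i < j)%N -> ht z0 <= ht z -> 0 <= z i -> z j = Negz q ->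
  (norm z + s = k)%N ->
  strace (pidx i) (pidx j) z = psum false (chi z i - chi z j) s.
Proof.
move=> lt_ij; have ij : i != j by apply/eqP => ij; rewrite ij ltnn in lt_ij.
have [m] := ubnP s; elim: m s z q => // m IH s z q lts hz zi zj nz.
have lti := ltn_ord i; have ltj := ltn_ord j.
have z'E : z + (wt (pidx i) - wt (pidx j)) = z + eps i - eps j by rewrite !wtE addrA.
have zi' : (z + eps i - eps j) i = z i + 1 by rewrite !ffunE eqxx eq_sym (negbTE ij) subr0.
have zj' : (z + eps i - eps j) j = z j - 1 by rewrite !ffunE eqxx (negbTE ij) addr0.
have hz' : ht z < ht (z + eps i - eps j) by rewrite !htD htN !ht_eps; lia.
have hz0 := le_lt_trans hz hz'.
have nz' : norm (z + eps i - eps j) = (norm z).+2.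
  have := norm_addr i z; have := norm_subr j (z + eps i).
  rewrite [(z + eps i) j]ffunE eps_neq 1?eq_sym // addr0 zj.
  have -> : Negz q - 1 = Negz q.+1 by lia.
  by case: (z i) zi => // r _ /=; lia.
case: s nz lts => [|[|s]] nz lts.
1,2: rewrite string_trace_eq0 ?z'E ?known ?expected_eq0 ?nz' //=; try lia;
  by rewrite ?addr0.
rewrite (string_trace_rec _ rep) ?barE ?idxE // z'E known //.
rewrite (expectedE _ s); last by rewrite nz'; lia.
rewrite (IH s _ q.+1) ?zi' ?zj' ?nz'; [|lia|exact: ltW|lia|lia|lia].
rewrite !diag_wtE /chi zi' zj' !rmorphD /= add0r addrC.
by congr (_ * _ + psum false _ s); ring.
Qed.

(** During the first z_j steps the norm is constant, and the factors z_i - z_j + 2t for t = 1, ...,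
    z_j add up to z_j (z_i + 1). The next step takes the j-th coordinate from 1/2 to -1/2 and raises
    the norm by 1 only; later steps raise it by 2, so the odd u appear. *)
Lemma strace_minus i j z s q : (i < j)%N -> ht z0 <= ht z -> 0 <= z i -> z j = Posz q ->
  (norm z + s = k)%N ->
  strace (pidx i) (pidx j) z =
  (z j)%:~R * ((z i)%:~R + 1) * (B s)%:R + psum true (chi z i + chi z j) s.
Proof.
move=> lt_ij; have ij : i != j by apply/eqP => ij; rewrite ij ltnn in lt_ij.
elim: q z => [|q IH] z hz zi zj nz.
all: have lti := ltn_ord i; have ltj := ltn_ord j.
all: have z'E : z + (wt (pidx i) - wt (pidx j)) = z + eps i - eps j by rewrite !wtE addrA.
all: have zi' : (z + eps i - eps j) i = z i + 1 by rewrite !ffunE eqxx eq_sym (negbTE ij) subr0.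
all: have zj' : (z + eps i - eps j) j = z j - 1 by rewrite !ffunE eqxx (negbTE ij) addr0.
all: have hz' : ht z < ht (z + eps i - eps j) by rewrite !htD htN !ht_eps; lia.
all: have hz0 := le_lt_trans hz hz'.
all: have nz' := norm_subr j (z + eps i); have nz'' := norm_addr i z.
all: rewrite [(z + eps i) j]ffunE eps_neq 1?eq_sym // addr0 zj in nz'.
  have {}nz' : norm (z + eps i - eps j) = (norm z).+1.
    by move: nz' nz''; case: (z i) zi => // r _ /=; lia.
  rewrite zj mul0r mul0r add0r.
  case: s nz => [|s] nz.
    rewrite string_trace_eq0 ?z'E ?known ?expected_eq0 ?nz' //=; by lia.
  rewrite (string_trace_rec _ rep) ?barE ?idxE // z'E known //.
  rewrite (expectedE _ s); last by rewrite nz'; lia.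
  rewrite (strace_minus_neg _ _ _ s 0) ?zi' ?zj' ?nz' //; [|exact: ltW|lia|by rewrite zj|lia].
  rewrite !diag_wtE /chi zi' zj' zj !rmorphD /= addrC.
  by congr (_ * _ + psum false _ s); field.
have {}nz' : norm (z + eps i - eps j) = norm z.
  have E : q.+1%:Z - 1 = q by lia.
  by move: nz' nz''; rewrite E; case: (z i) zi => // r _ /=; lia.
rewrite (string_trace_rec _ rep) ?barE ?idxE // z'E known //.
rewrite (expectedE _ s); last by rewrite nz'.
rewrite IH ?zi' ?zj' ?nz' //; [|exact: ltW|lia|by rewrite zj; lia].
rewrite !diag_wtE /chi zi' zj' !rmorphD /= addrAC.
congr (_ + psum true _ s); last by ring.
rewrite -mulrDl; congr (_ * _); ring.
Qed.

End Step.

(** * Summation over the positive roots *)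

Lemma sum_pair_left (x : 'I_n -> C) :
  \sum_(i < n) \sum_(j < n | (i < j)%N) x i + \sum_(i < n) \sum_(j < n | (i < j)%N) x j =
  (n%:R - 1) * \sum_i x i.
Proof.
have := sum_pairs (fun i j => x i); rewrite exchange_big /= sumr_const card_ord.
under [X in _ = _ + X]eq_bigr => i _ do rewrite big_split /=.
rewrite big_split /= => E; rewrite -[LHS](addKr (\sum_i x i)) -E -mulr_natl.
by ring.
Qed.

Lemma sum_pair_prod (x : 'I_n -> C) :
  (\sum_(i < n) \sum_(j < n | (i < j)%N) x i * x j) *+ 2 =
  (\sum_i x i) ^+ 2 - \sum_i x i ^+ 2.
Proof.
have := sum_pairs (fun i j => x i * x j); rewrite -big_distrlr /= -expr2 => ->.
rewrite addrC addrA addNr add0r -sumrMnl; apply: eq_bigr => i _.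
by rewrite -sumrMnl; apply: eq_bigr => j _; rewrite mulr2n [x j * _]mulrC.
Qed.

Lemma sum_pair_const : \sum_(i < n) \sum_(j < n | (i < j)%N) (1 : C) = n%:R * (n%:R - 1) / 2.
Proof.
have nz2 : 2 != 0 :> C by rewrite pnatr_eq0.
apply: (mulIf nz2); rewrite divfK // mulr_natr mulr2n (sum_pair_left (fun=> 1)).
by rewrite sumr_const card_ord mulrC.
Qed.

Lemma cas_valueE z (x := fun i => (z i)%:~R : C) :
  cas_value z = \sum_i x i ^+ 2 + (\sum_i x i) *+ 2 +
    (\sum_(i < n) \sum_(j < n | (i < j)%N) x i) *+ 2 +
    (n%:R * 3 / 4 + n%:R * (n%:R - 1) / 2) :> C.
Proof.
have S0 : \sum_i chi z i = \sum_i x i + n%:R / 2.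
  by rewrite big_split /= sumr_const card_ord -[_ *+ n]mulr_natl.
have S2 : \sum_i chi z i ^+ 2 = \sum_i x i ^+ 2 + \sum_i x i + n%:R / 4.
  rewrite (eq_bigr (fun i => x i ^+ 2 + x i + 4^-1)); last first.
    by move=> i _; rewrite /chi -/(x i); field.
  by rewrite !big_split /= sumr_const card_ord -[_ *+ n]mulr_natl.
have SP : \sum_(i < n) \sum_(j < n | (i < j)%N) chi z i *+ 2 =
    (\sum_(i < n) \sum_(j < n | (i < j)%N) x i) *+ 2 + n%:R * (n%:R - 1) / 2.
  rewrite -sum_pair_const -sumrMnl -big_split /=; apply: eq_bigr => i _.
  rewrite -sumrMnl -big_split /=; apply: eq_bigr => j _.
  by rewrite /chi -/(x i); field.
by rewrite /cas_value S0 S2 SP; field.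
Qed.

(** In this form both summands are visibly nonnegative for a weight with positive coordinates and
    norm at most k, and they match the two kinds of terms in the string sums. *)
Lemma cas_value_diff z (x := fun i => (z i)%:~R : C) (s := k%:R - \sum_i x i) :
  cas_value zlam - cas_value z =
  s * ((\sum_i x i) *+ 2 + n%:R *+ 2 + s) +
  (\sum_(i < n) \sum_(j < n | (i < j)%N) x j * (x i + 1)) *+ 2 :> C.
Proof.
have zlam_gt0 (j : 'I_n) : (0 < j)%N -> (zlam j)%:~R = 0 :> C.
  by case: j => -[|j] ltj //; rewrite ffunE.
have l1 : \sum_i (zlam i)%:~R = k%:R :> C.
  by rewrite -rmorph_sum /= -/(wtotal zlam) wtotal_zlam.
have l2 : \sum_i (zlam i)%:~R ^+ 2 = k%:R ^+ 2 :> C.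
  rewrite (bigD1 (Ordinal n_gt0)) //= big1 ?ffunE ?addr0 // => i ne.
  rewrite zlam_gt0 ?expr0n // lt0n; apply: contra_neq ne => i0; exact: ord_inj.
have l3 : \sum_(i < n) \sum_(j < n | (i < j)%N) (zlam i)%:~R = (n%:R - 1) * k%:R :> C.
  rewrite -l1 -sum_pair_left [X in _ = _ + X]big1 ?addr0 // => i _.
  by apply: big1 => j lt; apply: zlam_gt0; apply: leq_ltn_trans lt.
rewrite !cas_valueE l1 l2 l3.
have -> : \sum_(i < n) \sum_(j < n | (i < j)%N) x j * (x i + 1) =
    \sum_(i < n) \sum_(j < n | (i < j)%N) x i * x j +
    \sum_(i < n) \sum_(j < n | (i < j)%N) x j.
  rewrite -big_split /=; apply: eq_bigr => i _; rewrite -big_split /=; apply: eq_bigr => j _.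
  by rewrite mulrDr mulr1 mulrC.
rewrite mulrnDl sum_pair_prod.
have /eqP := sum_pair_left x; rewrite addrC eq_sym -subr_eq => /eqP <-.
by rewrite /s; ring.
Qed.

(** [full_sum] is affine in its first argument, so only the sums of the coordinates over roots
    enter. *)
Lemma full_sum_total z (s : nat) (x := fun i => (z i)%:~R : C) :
  \sum_(i < n) \sum_(j < n | (i < j)%N) fsum (chi z i + chi z j) s +
  \sum_i fsum (chi z i) s =
  s%:R * (B s)%:R * (\sum_i x i + n%:R + s%:R / 2).
Proof.
have nz : n%:R != 0 :> C by rewrite pnatr_eq0 -lt0n.
have nz1 : n%:R + 1 != 0 :> C by rewrite natr1 pnatr_eq0.
pose A : C := s%:R * (B s)%:R / (n%:R * (n%:R + 1)).
have fE y : fsum y s = A * (n%:R + 1) * y + A * (s%:R + n%:R).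
  by rewrite /full_sum /A; field; rewrite nz nz1.
have S0 : \sum_i chi z i = \sum_i x i + n%:R / 2.
  by rewrite big_split /= sumr_const card_ord -[_ *+ n]mulr_natl.
have -> : \sum_i fsum (chi z i) s =
    A * (n%:R + 1) * (\sum_i x i + n%:R / 2) + n%:R * (A * (s%:R + n%:R)).
  rewrite (eq_bigr _ (fun i _ => fE _)) big_split /= -mulr_sumr S0.
  by congr (_ + _); rewrite sumr_const card_ord mulr_natl.
have -> : \sum_(i < n) \sum_(j < n | (i < j)%N) fsum (chi z i + chi z j) s =
    A * (n%:R + 1) * ((n%:R - 1) * (\sum_i x i + n%:R / 2)) +
    A * (s%:R + n%:R) * (n%:R * (n%:R - 1) / 2).
  rewrite -S0 -sum_pair_left -sum_pair_const.
  rewrite -big_split mulr_sumr mulr_sumr -big_split /=; apply: eq_bigr => i _.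
  rewrite -big_split mulr_sumr mulr_sumr -big_split /=; apply: eq_bigr => j _.
  by rewrite mulr1 fE.
by rewrite /A; field; rewrite nz nz1.
Qed.

(** Twice the string sum equals [c0] times the expected multiplicity, so Freudenthal's formula gives
    the claim once [c0] is known to be nonzero. *)
Lemma mult_step z s : (forall z', ht z < ht z' -> mult z' = expected z') ->
  (forall i, 0 <= z i) -> (norm z + s = k)%N -> mult z = B s.
Proof.
move=> known z_ge0 nz.
pose y i := absn (z i); have yE i : z i = Posz (y i) by rewrite /y; case: (z i) (z_ge0 i).
have [zE|zn] := eqVneq z zlam.
  have := rank_wspace_highest _ rep irr _ _ v0_neq0 v0_weight v0_killed.
  rewrite -zE -/(mult z) => ->; suff -> : s = 0%N by rewrite /multichoose bin0.
  have := wtotal_absz z; rewrite absz_ffun_id // {1}zE wtotal_zlam => -[]; lia.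
have S1 : \sum_i (z i)%:~R = (norm z)%:R :> C.
  by rewrite /norm natr_sum; apply: eq_bigr => i _; rewrite yE.
(* The difference of Casimir values as a natural number, so that its vanishing forces every summand
   to vanish. *)
pose c0 : nat := (s * ((norm z).*2 + n.*2 + s) +
  (\sum_(i < n) \sum_(j < n | (i < j)%N) y j * (y i).+1).*2)%N.
have sE : s%:R = k%:R - \sum_i (z i)%:~R :> C by rewrite S1 -nz natrD addrC addKr.
have c0P : (\sum_(i < n) \sum_(j < n | (i < j)%N) y j * (y i).+1)%N%:R =
    \sum_(i < n) \sum_(j < n | (i < j)%N) (z j)%:~R * ((z i)%:~R + 1) :> C.
  rewrite natr_sum; apply: eq_bigr => i _; rewrite natr_sum; apply: eq_bigr => j _.
  by rewrite natrM -natr1 !yE.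
have c0E : c0%:R = cas_value zlam - cas_value z :> C.
  rewrite cas_value_diff -sE S1 -c0P /c0 -!muln2 natrD !natrM !natrD !natrM.
  by ring.
have ssE : string_sum rho z =
    (B s)%:R * (\sum_(i < n) \sum_(j < n | (i < j)%N) (z j)%:~R * ((z i)%:~R + 1)) +
    s%:R * (B s)%:R * ((norm z)%:R + n%:R + s%:R / 2).
  rewrite -S1 -full_sum_total /string_sum addrA; congr (_ + _).
    rewrite mulr_sumr -big_split /=; apply: eq_bigr => i _.
    rewrite mulr_sumr -big_split /=; apply: eq_bigr => j lt.
    rewrite (strace_minus _ known _ _ _ s (y j)) //.
    rewrite (strace_plus _ known _ _ _ s) //; last first.
      by apply/eqP => ij; rewrite ij ltnn in lt.
    by rewrite -(parity_sum_full n n_gt0) -addrA; congr (_ + _); rewrite mulrC.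
  by apply: eq_bigr => i _; rewrite (strace_short _ known _ _ s).
have c0eq : c0%:R * (mult z)%:R = c0%:R * (B s)%:R :> C.
  have := freudenthal _ rep irr _ _ v0_neq0 v0_weight v0_killed z.
  rewrite {1}c0E mulrBl => ->; rewrite addrC addKr ssE -c0P.
  by rewrite /c0 -!muln2 !(natrD, natrM); field.
have c0_neq0 : c0 != 0%N.
  apply: contra_neq zn => /eqP; rewrite /c0 addn_eq0 double_eq0 muln_eq0.
  rewrite [(_ + s == 0)%N]addn_eq0 addn_eq0 !double_eq0 [n == 0%N]gtn_eqF // andbF orbF.
  (* As n > 0, vanishing of the first summand gives s = 0. In the second, the terms with i the first
     index have the positive factor y_i + 1, so all other coordinates vanish and [z] is the highest
     weight. *)
  case/andP=> /eqP s0; rewrite sum_nat_eq0 => /forallP /(_ (Ordinal n_gt0)).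
  rewrite /= sum_nat_eq0 => /forallP y0.
  have z_0 (j : 'I_n) : (0 < j)%N -> z j = 0.
    by move=> lt; have := y0 j; rewrite lt /= muln_eq0 orbF => /eqP; rewrite yE => ->.
  apply/ffunP => j; rewrite ffunE; case: posnP => [j0|]; last exact: z_0.
  have := wtotal_absz z; rewrite absz_ffun_id // /wtotal (bigD1 j) //= big1 ?addr0.
    by move=> ->; rewrite -nz s0 addn0.
  move=> l ne; apply: z_0; rewrite lt0n; apply: contra_neq ne => l0.
  by apply: ord_inj; rewrite l0 j0.
move/eqP: c0eq; rewrite -!natrM eqr_nat eqn_pmul2l ?lt0n // => /eqP //.
Qed.

(** Downward induction on the height, which is at most n k for weights of norm at most k. Passing to
    positive coordinates does not lower the height, so the induction hypothesis still covers
    everything above. *)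
Lemma mult_expected z : mult z = expected z.
Proof.
suff H (t : nat) z' : (n * k)%N%:Z - ht z' < t -> mult z' = expected z'.
  by apply: (H `|(n * k)%N%:Z - ht z|.+1); lia.
elim: t z' => [|t IH] z' ltt; have [lt|le] := ltnP k (norm z').
1,3: by rewrite mult_support // expected_eq0.
  have := ht_norm z'; have : (n * norm z' <= n * k)%N by rewrite leq_mul2l le orbT.
  lia.
rewrite -(mult_absz _ rep) (expectedE _ (k - norm z')) ?subnKC //.
apply: mult_step => [w lt|i|]; last by rewrite norm_absz subnKC.
  by apply: IH; have := ht_absz z'; lia.
by rewrite ffunE.
Qed.

End Multiplicities.

(** * Translation to rational weights *)

Lemma normr_half (x : int) : `|x%:~R + 2%:R^-1| = (absn x)%:R + 2%:R^-1 :> rat.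
Proof.
case: x => q /=; first by rewrite ger0_norm ?addr_ge0 ?invr_ge0 ?ler0n // -pmulrn.
rewrite NegzE -normrN ger0_norm; first by rewrite rmorphN /= -pmulrn -[q.+1%:R]natr1; field.
have -> : - ((- q.+1%:Z)%:~R + 2%:R^-1) = q%:R + 2%:R^-1 :> rat.
  by rewrite rmorphN /= -pmulrn -[q.+1%:R]natr1; field.
by rewrite addr_ge0 ?invr_ge0 ?ler0n.
Qed.

Theorem theorem5p3 (C : numClosedFieldType) (n k : nat) (hn : (2 <= n)%N)
    (d : nat) (rho : 'M[C]_(n.*2.+1) -> 'M[C]_d) :
  is_rep C n d rho -> irreducible_rep C n d rho -> has_highest_weight C n d rho (lam_k n k) ->
  (forall mu : 'I_n -> rat, in_Pg_minus_PG n mu ->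
     exists r : int,
       r%:~R = k%:R + n%:R / 2%:R - wnorm n mu /\
       wmult C n d rho mu = binomZ (r + n%:Z - 1) (n%:Z - 1)) /\
  (forall mu : 'I_n -> rat, in_PG n mu -> wmult C n d rho mu = 0%N).
Proof.
move=> rep irr [v [v_neq0 [v_wt v_kill]]].
have n_gt0 : (0 < n)%N by apply: leq_trans hn.
have half : ratr 2%:R^-1 = 2^-1 :> C by rewrite fmorphV /= rmorph_nat.
have v0_neq0 : v^T != 0 by rewrite trmx_eq0.
have v0_weight : weight_vector rho v^T (@zlam n k).
  move=> i; rewrite -trmx_mul v_wt linearZ /=; congr (_ *: _).
  rewrite /lam_k /chi ffunE rmorphD /= half; congr (_ + _).
  by case: eqP => _; rewrite ?rmorph_nat ?rmorph0.
have v0_killed a b := highest_killed rho rep v a b v_kill.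
split=> mu muP.
  have [z zE] : exists z : {ffun 'I_n -> int}, forall i, mu i = (z i)%:~R + 2%:R^-1.
    by have [z zE] := fin_all_exists muP; exists (finfun z) => i; rewrite ffunE.
  have wE : wmult C n d rho mu = mult rho z.
    rewrite /wmult /mult /wspace; congr (\rank _); apply: eq_bigr => i _.
    by rewrite zE rmorphD /= half ratr_int.
  (* Each coordinate has absolute value [absn (z i)] + 1/2, so the halves add up to the n/2 in the
     definition of r. *)
  exists (k%:Z - (norm z)%:Z); split.
    rewrite rmorphB /= -!pmulrn; have -> : wnorm n mu = (norm z)%:R + n%:R / 2.
      rewrite /wnorm (eq_bigr _ (fun i _ => congr1 Num.norm (zE i))).
      rewrite (eq_bigr _ (fun i _ => normr_half _)) big_split /= sumr_const card_ord.
      by rewrite /norm natr_sum -[_^-1 *+ n]mulr_natl.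
    by field.
  rewrite wE (mult_expected rho k n_gt0 rep irr v^T v0_neq0 v0_weight v0_killed).
  rewrite /expected /binomZ /multichoose; case: leqP => [le|lt]; last first.
    (* Here r < 0, so the upper index is below n - 1 and the binomial coefficient is 0 by
       convention. *)
    by rewrite ifT //; lia.
  rewrite ifF; last by lia.
  have -> : absz (k%:Z - (norm z)%:Z + n%:Z - 1)%R = (k - norm z + n.-1)%N by lia.
  have -> : absz (n%:Z - 1)%R = n.-1 by lia.
  by rewrite -[in RHS]bin_sub ?leq_addl // addnK.
rewrite /wmult; apply/eqP; rewrite mxrank_eq0 -submx0; apply/rV_subP => u uP.
have [->|u0] := eqVneq u 0; first by rewrite sub0mx.
have uw i : u *m act rho (Hcart C n i) = ratr (mu i) *: u.
  move/sub_bigcapmxP: uP => /(_ i isT).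
  by rewrite sub_kermx mulmxBr mul_mx_scalar subr_eq0 => /eqP.
have [z _ zE] := weight_in_support rho rep irr _ _ v0_neq0 v0_weight v0_killed u _ u0 uw.
have [x xE] := muP (Ordinal n_gt0).
have := zE (Ordinal n_gt0); rewrite xE ratr_int /chi => E.
(* An integral coordinate equal to a half-integral one would make an even integer equal to an odd
   one. *)
have : (x * 2)%:~R = (z (Ordinal n_gt0) * 2 + 1)%:~R :> C.
  by rewrite rmorphD !rmorphM /= E; field.
by move/intr_inj; lia.
Qed.
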